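(* Let $E_{222}$ be the elliptic curve over the function field $\mathbb{Q}(a)$ given by \[ y^2 = x^3 + \left(16a + \tfrac{942}{13}\right)x^2 + \left(\tfrac{10048}{13}a + \tfrac{293084}{169}\right)x + 1024a^2 + \tfrac{1620800}{169}a + \tfrac{30250696}{2197}. \] Then $E_{222}(\mathbb{Q}(a))$ has rank $2$ and is generated by the two independent points $P(a) = \left(-\tfrac{262}{13},\, 32a+8\right)$ and $Q(a) = \left(-\tfrac{366}{13},\, 32a+8\right)$.
   Context: $E_{222}$ is a Weierstrass model of the genus-one curve $V(z_2^2 + z_1 z_3 - z_0^2 - a z_3^2,\, z_2^2 + z_2 z_3 - z_1^2 - a z_3^2) \subset \mathbb{P}^3_{\mathbb{Q}(a)}$, which parametrizes (for $f_c(x) = x^2+c$) third pre-images of $a$; its discriminant is $(4a+1)^2(256a^3+368a^2+104a+23)$. *)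

(* Defs.v *)
From HB Require Import structures.
From mathcomp Require Import all_boot all_order all_algebra ring.

Set Implicit Arguments.
Unset Strict Implicit.
Unset Printing Implicit Defensive.

Import GRing.Theory.
Local Open Scope ring_scope.

(* Elliptic curves y ^ 2 = x ^ 3 + a2 x ^ 2 + a4 x + a6 over a field.  The
   factor 16 of the discriminant rules out characteristic 2. *)
Definition wdisc (K : fieldType) (a2 a4 a6 : K) : K :=
  16 * (a2 ^+ 2 * a4 ^+ 2 - 4 * a4 ^+ 3 - 4 * a2 ^+ 3 * a6
        + 18 * a2 * a4 * a6 - 27 * a6 ^+ 2).

Record ecurve (K : fieldType) := ECurve {
  ec_a2 : K;
  ec_a4 : K;
  ec_a6 : K;
  ec_disc_neq0 : wdisc ec_a2 ec_a4 ec_a6 != 0 }.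

Section RawPoints.
Variables (K : fieldType) (E : ecurve K).

Local Notation a2 := (ec_a2 E).
Local Notation a4 := (ec_a4 E).
Local Notation a6 := (ec_a6 E).

(* [None] is the point at infinity. *)
Definition oncurve (p : option (K * K)) : bool :=
  if p is Some (x, y) then y ^+ 2 == x ^+ 3 + a2 * x ^+ 2 + a4 * x + a6
  else true.

Definition raw_opp (p : option (K * K)) : option (K * K) :=
  if p is Some (x, y) then Some (x, - y) else None.

(* Slope of the chord, or of the tangent when both abscissas agree. *)
Definition slope (x1 y1 x2 y2 : K) : K :=
  if x1 == x2 then (3 * x1 ^+ 2 + 2 * a2 * x1 + a4) / (2 * y1)
  else (y1 - y2) / (x1 - x2).

Definition raw_add (p q : option (K * K)) : option (K * K) :=
  match p, q with
  | None, _ => q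
  | _, None => p
  | Some (x1, y1), Some (x2, y2) =>
      if (x1 == x2) && (y1 == - y2) then None
      else let s := slope x1 y1 x2 y2 in
           let x3 := s ^+ 2 - a2 - x1 - x2 in
           Some (x3, s * (x1 - x3) - y1)
  end.

Lemma two_neq0 : 2 != 0 :> K.
Proof.
apply: contraNneq (ec_disc_neq0 E) => h; apply/eqP; rewrite /wdisc.
have -> : 16 = 2 * 8 :> K by ring.
by rewrite h !mul0r.
Qed.

Let is_slope (x1 y1 x2 y2 s : K) : Prop :=
  y1 - y2 = s * (x1 - x2) /\
  s * (y1 + y2) = x1 ^+ 2 + x1 * x2 + x2 ^+ 2 + a2 * (x1 + x2) + a4.

Lemma opp_fix (y : K) : y = - y -> y = 0.
Proof.
move=> h; apply/eqP; have: 2 * y == 0 by apply/eqP; rewrite mulr_natl mulr2n {2}h subrr.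
by rewrite mulf_eq0 (negPf two_neq0).
Qed.

Lemma oncurve_same_x (x y1 y2 : K) :
  oncurve (Some (x, y1)) -> oncurve (Some (x, y2)) -> y1 = y2 \/ y1 = - y2.
Proof.
move=> /eqP h1 /eqP h2; have /eqP : y1 ^+ 2 = y2 ^+ 2 by rewrite h1 h2.
by rewrite eqf_sqr => /orP[/eqP|/eqP]; [left | right].
Qed.

Lemma slopeP (x1 y1 x2 y2 : K) :
  oncurve (Some (x1, y1)) -> oncurve (Some (x2, y2)) ->
  ~~ ((x1 == x2) && (y1 == - y2)) -> is_slope x1 y1 x2 y2 (slope x1 y1 x2 y2).
Proof.
move=> h1 h2; rewrite /slope; case: eqVneq => [ex|nx] /= nE.
  subst x2; case: (oncurve_same_x h1 h2) => ey; last by rewrite ey eqxx in nE.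
  subst y2; have ny : y1 != 0.
    by apply: contraNneq nE => ->; rewrite oppr0.
  have n2 := two_neq0.
  by split; [ring | field; rewrite ny].
have n12 : x1 - x2 != 0 by rewrite subr_eq0.
split; first by field.
move: h1 h2 => /eqP h1 /eqP h2.
apply: (mulfI n12); rewrite mulrA mulrC.
have -> : (x1 - x2) * ((y1 - y2) / (x1 - x2)) = y1 - y2 by field.
have -> : (y1 + y2) * (y1 - y2) = y1 ^+ 2 - y2 ^+ 2 by ring.
by rewrite h1 h2; ring.
Qed.

Lemma is_slope_add (x1 y1 x2 y2 s : K) :
  oncurve (Some (x1, y1)) -> oncurve (Some (x2, y2)) ->
  ~~ ((x1 == x2) && (y1 == - y2)) -> is_slope x1 y1 x2 y2 s ->
  raw_add (Some (x1, y1)) (Some (x2, y2)) =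
    Some (s ^+ 2 - a2 - x1 - x2, s * (x1 - (s ^+ 2 - a2 - x1 - x2)) - y1).
Proof.
move=> h1 h2 n12 [s1 s2]; rewrite /raw_add (negPf n12).
suff -> : slope x1 y1 x2 y2 = s by [].
have [t1 t2] := slopeP h1 h2 n12.
move: n12; rewrite negb_and => /orP[nx|ny].
  have d : x1 - x2 != 0 by rewrite subr_eq0.
  by apply: (mulIf d); rewrite -t1 -s1.
have d : y1 + y2 != 0 by rewrite addr_eq0.
by apply: (mulIf d); rewrite t2 s2.
Qed.

Lemma oncurve_opp (p : option (K * K)) : oncurve p -> oncurve (raw_opp p).
Proof. by case: p => [[x y]|] //=; rewrite sqrrN. Qed.

Lemma oncurve_add (p q : option (K * K)) :
  oncurve p -> oncurve q -> oncurve (raw_add p q).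
Proof.
case: p q => [[x1 y1]|] [[x2 y2]|] // h1 h2.
case n12 : ((x1 == x2) && (y1 == - y2)); first by rewrite /raw_add n12.
have {}n12 := negbT n12; have hs := slopeP h1 h2 n12.
rewrite (is_slope_add h1 h2 n12 hs); move: (slope _ _ _ _) hs => s [s1 s2].
move: h1 h2 => /eqP h1 /eqP h2; rewrite /oncurve; apply/eqP.
have e2 : y2 = y1 - s * (x1 - x2) by rewrite -s1; ring.
have e4 : a4 = s * (y1 + y2) - (x1 ^+ 2 + x1 * x2 + x2 ^+ 2 + a2 * (x1 + x2)).
  by rewrite s2; ring.
have e6 : a6 = y1 ^+ 2 - x1 ^+ 3 - a2 * x1 ^+ 2 - a4 * x1 by rewrite h1; ring.
by rewrite e6 e4 e2; ring.
Qed.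

Lemma raw_addC (p q : option (K * K)) :
  oncurve p -> oncurve q -> raw_add p q = raw_add q p.
Proof.
case: p q => [[x1 y1]|] [[x2 y2]|] // h1 h2.
case n12 : ((x1 == x2) && (y1 == - y2)).
  rewrite /raw_add n12; case/andP: n12 => /eqP -> /eqP ->.
  by rewrite opprK !eqxx.
have {}n12 := negbT n12; have hs := slopeP h1 h2 n12.
have n21 : ~~ ((x2 == x1) && (y2 == - y1)).
  by apply: contra n12 => /andP[/eqP -> /eqP ->]; rewrite opprK !eqxx.
rewrite (is_slope_add h1 h2 n12 hs); case: (hs) => s1 s2.
rewrite (@is_slope_add _ _ _ _ (slope x1 y1 x2 y2) h2 h1 n21); last first.
  by split; [rewrite -opprB s1; ring | rewrite addrC s2; ring].
have e2 : y2 = y1 - slope x1 y1 x2 y2 * (x1 - x2) by rewrite -s1; ring.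
by congr (Some (_, _)); [ring | rewrite [X in _ = _ - X]e2; ring].
Qed.

Lemma raw_addN (p : option (K * K)) : raw_add (raw_opp p) p = None.
Proof. by case: p => [[x y]|] //=; rewrite !eqxx. Qed.

Lemma raw_add_eq0 (p q : option (K * K)) :
  raw_add p q = None -> p = raw_opp q.
Proof.
case: p q => [[x1 y1]|] [[x2 y2]|] //=.
by case: ifP => // /andP[/eqP -> /eqP ->].
Qed.

Lemma raw_addNN (p q : option (K * K)) : oncurve p -> oncurve q ->
  raw_add (raw_opp p) (raw_opp q) = raw_opp (raw_add p q).
Proof.
case: p q => [[x1 y1]|] [[x2 y2]|] // h1 h2.
case n12 : ((x1 == x2) && (y1 == - y2)).
  by rewrite /raw_add /= eqr_opp n12.
have {}n12 := negbT n12; have [s1 s2] := slopeP h1 h2 n12.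
rewrite (is_slope_add h1 h2 n12 (conj s1 s2)) /raw_opp.
rewrite (@is_slope_add _ _ _ _ (- slope x1 y1 x2 y2)).
- by congr (Some (_, _)); ring.
- exact: (oncurve_opp h1).
- exact: (oncurve_opp h2).
- by rewrite eqr_opp.
- by split; [rewrite -opprB opprK addrC s1 | rewrite -s2]; ring.
Qed.

Lemma raw_addK (p q : option (K * K)) : oncurve p -> oncurve q ->
  raw_add (raw_add p q) (raw_opp q) = p.
Proof.
case: p q => [[x1 y1]|] [[x2 y2]|] // h1 h2; last first.
  by rewrite raw_addC ?raw_addN //; apply: oncurve_opp.
case n12 : ((x1 == x2) && (y1 == - y2)).
  by rewrite /raw_add n12 /=; case/andP: n12 => /eqP -> /eqP ->.
have {}n12 := negbT n12; have hs := slopeP h1 h2 n12.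
have h3 := oncurve_add h1 h2; move: h3.
rewrite (is_slope_add h1 h2 n12 hs).
move: (slope _ _ _ _) hs => s [s1 s2].
set x3 := s ^+ 2 - _ - _ - _; set y3 := s * _ - _ => h3.
have e1 : y1 = y2 + s * (x1 - x2) by rewrite -s1; ring.
have e4 : a4 = s * (y1 + y2) - (x1 ^+ 2 + x1 * x2 + x2 ^+ 2 + a2 * (x1 + x2)).
  by rewrite s2; ring.
have n3 : ~~ ((x3 == x2) && (y3 == - - y2)).
  rewrite opprK; apply/negP => /andP[/eqP ex /eqP ey].
  have y20 : y2 = 0.
    apply: opp_fix; rewrite -{1}ey /y3 ex e1; ring.
  have ex1 : x1 = s ^+ 2 - a2 - x2 - x2 by rewrite -{2}ex /x3; ring.
  have d4 : a4 = - (3 * x2 ^+ 2 + 2 * a2 * x2).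
    by rewrite e4 e1 y20 ex1; ring.
  have d6 : a6 = - (x2 ^+ 3 + a2 * x2 ^+ 2 + a4 * x2).
    by apply/eqP; rewrite -subr_eq0 opprK addrC -(eqP h2) y20 expr0n.
  by case/negP: (ec_disc_neq0 E); apply/eqP; rewrite /wdisc d6 d4; ring.
rewrite /raw_opp (@is_slope_add _ _ _ _ (- s) h3 (oncurve_opp h2) n3).
  congr (Some (_, _)); first by rewrite /x3; ring.
  by rewrite /y3 /x3; ring.
by split; rewrite ?e4 /y3 e1 /x3; ring.
Qed.

(* Both outer additions are chords here; [ec_addA] reduces to this case. *)
Lemma raw_addA_gen (x1 y1 x2 y2 x3 y3 : K) :
  oncurve (Some (x1, y1)) -> oncurve (Some (x2, y2)) ->
  oncurve (Some (x3, y3)) ->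
  ~~ ((x1 == x2) && (y1 == - y2)) -> ~~ ((x2 == x3) && (y2 == - y3)) ->
  (if raw_add (Some (x1, y1)) (Some (x2, y2)) is Some (x, _)
   then x != x3 else true) ->
  (if raw_add (Some (x2, y2)) (Some (x3, y3)) is Some (x, _)
   then x1 != x else true) ->
  raw_add (raw_add (Some (x1, y1)) (Some (x2, y2))) (Some (x3, y3)) =
  raw_add (Some (x1, y1)) (raw_add (Some (x2, y2)) (Some (x3, y3))).
Proof.
move=> h1 h2 h3 n12 n23.
have [s1 s2] := slopeP h1 h2 n12; have [t1 t2] := slopeP h2 h3 n23.
rewrite (is_slope_add h1 h2 n12 (conj s1 s2)).
rewrite (is_slope_add h2 h3 n23 (conj t1 t2)).
move: (slope x1 _ _ _) (slope x2 _ _ _) s1 s2 t1 t2 => s t s1 s2 t1 t2 nX nZ.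
rewrite /raw_add /slope (negPf nX) (negPf nZ) /=.
have X0 : s ^+ 2 - a2 - x1 - x2 - x3 != 0 by rewrite subr_eq0.
have Z0 : x1 - (t ^+ 2 - a2 - x2 - x3) != 0 by rewrite subr_eq0.
have e1 : y1 = y2 + s * (x1 - x2) by rewrite -s1; ring.
have e3 : y3 = y2 + t * (x3 - x2) by rewrite -[_ - _]opprB mulrN -t1; ring.
have r : 2 * (s - t) * y2 = (x1 - x3) * (x1 + x2 + x3 + a2)
           - s ^+ 2 * (x1 - x2) + t ^+ 2 * (x3 - x2).
  have : s * (y1 + y2) - t * (y2 + y3) = (x1 - x3) * (x1 + x2 + x3 + a2).
    by rewrite s2 t2; ring.
  by move <-; rewrite e1 e3; ring.
have n2 := two_neq0.
have [est|nst] := eqVneq s t.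
  have /eqP : (x1 - x3) * (s ^+ 2 - a2 - x1 - x2 - x3) = 0.
    have -> : (x1 - x3) * (s ^+ 2 - a2 - x1 - x2 - x3) =
      - ((x1 - x3) * (x1 + x2 + x3 + a2) - s ^+ 2 * (x1 - x2) + s ^+ 2 * (x3 - x2)).
      by ring.
    by rewrite {2}est -r est subrr mulr0 mul0r oppr0.
  rewrite mulf_eq0 (negPf X0) orbF subr_eq0 => /eqP ex; subst x3 t.
  have ey : y1 = y3 by rewrite e1 e3.
  subst y3; rewrite e1.
  congr (Some (_, _)); field; rewrite ?X0 ?Z0 //=.
have nst' : s - t != 0 by rewrite subr_eq0.
have ey2 : y2 = ((x1 - x3) * (x1 + x2 + x3 + a2)
           - s ^+ 2 * (x1 - x2) + t ^+ 2 * (x3 - x2)) / (2 * (s - t)).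
  by rewrite -r; field; rewrite nst'.
by congr (Some (_, _)); rewrite e1 e3 ey2; field; rewrite ?nst' ?X0 ?Z0 ?n2.
Qed.

End RawPoints.

Record point (K : fieldType) (E : ecurve K) := Point {
  point_val :> option (K * K);
  point_on : oncurve E point_val }.

HB.instance Definition _ (K : fieldType) (E : ecurve K) :=
  [isSub for @point_val K E].
HB.instance Definition _ (K : fieldType) (E : ecurve K) :=
  [Choice of point E by <:].

Section PointGroup.
Variables (K : fieldType) (E : ecurve K).
Implicit Types p q r : point E.

Definition ec_zero : point E := @Point K E None isT.
Definition ec_opp p : point E := Point (oncurve_opp (point_on p)).
Definition ec_add p q : point E :=
  Point (oncurve_add (point_on p) (point_on q)).

Declare Scope point_scope.
Local Open Scope point_scope.
Local Notation "0" := ec_zero : point_scope.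
Local Notation "- p" := (ec_opp p) : point_scope.
Local Notation "p + q" := (ec_add p q) : point_scope.
Local Notation "p - q" := (p + - q) : point_scope.

Lemma ec_addC : commutative ec_add.
Proof. by move=> p q; apply/val_inj/raw_addC; apply: point_on. Qed.

Lemma ec_add0 : left_id 0 ec_add.
Proof. by move=> p; apply/val_inj. Qed.

Lemma ec_addN : left_inverse 0 ec_opp ec_add.
Proof. by move=> p; apply/val_inj/raw_addN. Qed.

Let addr0p p : p + 0 = p. Proof. by rewrite ec_addC ec_add0. Qed.

Let addNr p : p - p = 0. Proof. by rewrite ec_addC ec_addN. Qed.

Let oppK p : - - p = p.
Proof. by apply: val_inj; case: p => [[[x y]|] h] //=; rewrite opprK. Qed.

Let opp0 : - 0 = 0. Proof. exact: val_inj. Qed.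

Let oppD p q : - (p + q) = - p - q.
Proof. by apply/esym/val_inj/raw_addNN; apply: point_on. Qed.

Let addK p q : p + q - q = p.
Proof. by apply/val_inj/raw_addK; apply: point_on. Qed.

Let subK p q : p - q + q = p.
Proof. by rewrite -{2}[q]oppK addK. Qed.

Let addI p q r : p + q = r -> p = r - q.
Proof. by move <-; rewrite addK. Qed.

Let add_eq0 p q : p + q = 0 -> p = - q.
Proof. by move=> /addI ->; rewrite ec_add0. Qed.

Let same_x p q (x y x' y' : K) : point_val p = Some (x, y) ->
  point_val q = Some (x', y') -> x = x' -> p = q \/ p = - q.
Proof.
case: p q => [p hp] [q hq] /= ep eq ex; subst p q x'.
case: (oncurve_same_x hp hq) => ey; [left | right]; apply: val_inj => /=;
  by rewrite ey.
Qed.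

Let assoc_gen p q r : p + q <> r -> p <> q + r ->
  p + q + r = p + (q + r).
Proof.
move=> n3 n4.
case: (eqVneq p 0) => [->|p0]; first by rewrite !ec_add0.
case: (eqVneq q 0) => [->|q0]; first by rewrite addr0p ec_add0.
case: (eqVneq r 0) => [->|r0]; first by rewrite !addr0p.
case: (eqVneq (p + q) 0) => [e|npq].
  by rewrite e ec_add0 (add_eq0 e) ec_addC [q + r]ec_addC addK.
case: (eqVneq (q + r) 0) => [e|nqr].
  by rewrite e addr0p; move: e; rewrite ec_addC => /add_eq0 ->; rewrite addK.
case: (eqVneq (p + q) (- r)) => [e|m3].
  rewrite e ec_addN; have -> : p = - (q + r).
    by rewrite oppD [- q - r]ec_addC; apply: addI.
  by rewrite ec_addN.
case: (eqVneq p (- (q + r))) => [e|m4].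
  rewrite e ec_addN oppD; have -> : - q - r + q = - r.
    by rewrite [- q - r]ec_addC subK.
  by rewrite ec_addN.
have ndeg (u v : point E) x y x' y' : point_val u = Some (x, y) ->
    point_val v = Some (x', y') -> u + v != 0 ->
    ~~ ((x == x') && (y == (- y')%R)).
  move=> eu ev; apply: contra => /andP[/eqP ex /eqP ey]; apply/eqP/val_inj.
  by rewrite /= eu ev /= ex ey !eqxx.
apply: val_inj; rewrite /=.
case: p q r p0 q0 r0 n3 n4 m3 m4 npq nqr => [[[x1 y1]|] h1] // [[[x2 y2]|] h2] //
  [[[x3 y3]|] h3] // _ _ _ n3 n4 m3 m4 npq nqr /=.
apply: raw_addA_gen => //.
- exact: ndeg npq.
- exact: ndeg nqr.
- case e: (raw_add _ _ _) => [[x y]|] //; apply/negP => /eqP ex.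
  case: (@same_x (Point h1 + Point h2) (Point h3) x y x3 y3) => // e'.
  by rewrite e' eqxx in m3.
- case e: (raw_add _ _ _) => [[x y]|] //; apply/negP => /eqP ex.
  case: (@same_x (Point h1) (Point h2 + Point h3) x1 y1 x y) => // e'.
  by rewrite e' eqxx in m4.
Qed.

Let double_add_gen p q : p + p <> q -> p + p + q = p + (p + q).
Proof.
move=> n; case: (eqVneq q 0) => [->|q0]; first by rewrite !addr0p.
apply: assoc_gen => //; rewrite ec_addC => /esym/addI e.
by case/eqP: q0; rewrite e addNr.
Qed.

Let four p : p + p + (p + p) = p + (p + (p + p)).
Proof.
set s := p + p; have sp : s - p = p by rewrite addK.
have [e|n] := eqVneq (s + s) (- p).
  have -> : p + s = - s by rewrite -[p]oppK -e oppD subK.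
  by rewrite e /s oppD ec_addC subK.
have := double_add_gen (elimN eqP n); rewrite sp => /addI.
by rewrite oppK => ->; rewrite ec_addC [s + p]ec_addC.
Qed.

Let double_add p q : p + p + q = p + (p + q).
Proof.
have [<-|n] := eqVneq (p + p) q; first exact: four.
by apply/double_add_gen/eqP.
Qed.

Lemma ec_addA : associative ec_add.
Proof.
have T3 p q : p + q + (p + q) = p + (q + (p + q)).
  set r := p + q; have := double_add r (- p).
  have -> : r - p = q by rewrite /r ec_addC [p + q]ec_addC ec_addC addK.
  by move=> /addI; rewrite oppK => ->; rewrite ec_addC [r + q]ec_addC.
move=> p q r; apply/esym.
have [<-|n3] := eqVneq (p + q) r; first exact: T3.
have [->|n4] := eqVneq p (q + r).
  by rewrite [q + r]ec_addC [r + q + q]ec_addC [_ + r]ec_addC -T3.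
by apply: assoc_gen; apply/eqP.
Qed.

End PointGroup.

HB.instance Definition _ (K : fieldType) (E : ecurve K) :=
  GRing.isZmodule.Build (point E) (@ec_addA K E) (@ec_addC K E)
    (@ec_add0 K E) (@ec_addN K E).

Section ZRank.
Variable V : zmodType.

Definition zcomb (n : nat) (p : n.-tuple V) (c : 'I_n -> int) : V :=
  \sum_(i < n) tnth p i *~ c i.

Definition zindependent (n : nat) (p : n.-tuple V) : Prop :=
  forall c : 'I_n -> int, zcomb p c = 0 -> forall i, c i = 0.

Definition zgenerates (n : nat) (p : n.-tuple V) : Prop :=
  forall v : V, exists c : 'I_n -> int, v = zcomb p c.

Definition has_zrank (r : nat) : Prop :=
  (exists p : r.-tuple V, zindependent p) /\
  (forall (n : nat) (p : n.-tuple V), zindependent p -> (n <= r)%N).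

End ZRank.

Definition Qa : fieldType := {fraction {poly rat}}.

Definition a_ : Qa := tofrac 'X.

(* A bare numeral above 5000 is expanded in unary and overflows the stack; the
   explicit [n%:R] form is not. *)
Definition E222_a2 : Qa := 16 * a_ + 942 / 13.
Definition E222_a4 : Qa := 10048%:R / 13 * a_ + 293084%:R / 169.
Definition E222_a6 : Qa :=
  1024 * a_ ^+ 2 + 1620800%:R / 169 * a_ + 30250696%:R / 2197.

Lemma Qa_natr_neq0 (n : nat) : (0 < n)%N -> n%:R != 0 :> Qa.
Proof.
move=> n0; rewrite -(rmorph_nat (@tofrac {poly rat})) tofrac_eq0.
by rewrite -polyC_natr polyC_eq0 Num.Theory.pnatr_eq0 -lt0n.
Qed.

Lemma Qa_poly_neq0 (q : {poly rat}) (n : nat) :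
  (0 < n)%N -> tofrac q * a_ + n%:R != 0 :> Qa.
Proof.
move=> n0; rewrite -(rmorph_nat (@tofrac {poly rat})) -rmorphM -rmorphD.
rewrite tofrac_eq0; apply: contraTneq n0 => /(congr1 (horner^~ 0)).
rewrite /= hornerD hornerMX mulr0 add0r -polyC_natr hornerC horner0 => /eqP.
by rewrite Num.Theory.pnatr_eq0 lt0n negbK.
Qed.

Lemma Qa_cubic_neq0 (c3 c2 c1 c0 : nat) : (0 < c0)%N ->
  c3%:R * a_ ^+ 3 + c2%:R * a_ ^+ 2 + c1%:R * a_ + c0%:R != 0 :> Qa.
Proof.
move=> n0.
have := Qa_poly_neq0 (c3%:R * 'X ^+ 2 + c2%:R * 'X + c1%:R) n0.
rewrite !rmorphD !(rmorphXn, rmorphM) !rmorph_nat !mulrDl -!mulrA.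
by rewrite -[_ 'X]/a_ -expr2 -exprS.
Qed.

(* Stated over an abstract field, where [field] is fast. *)
Lemma E222_wdisc_gen (F : fieldType) (a : F) :
  13 != 0 :> F -> 169 != 0 :> F -> 2197 != 0 :> F ->
  wdisc (16 * a + 942 / 13) (10048%:R / 13 * a + 293084%:R / 169)
    (1024 * a ^+ 2 + 1620800%:R / 169 * a + 30250696%:R / 2197) =
  - 2 ^+ 16 * ((4 * a + 1) ^+ 2
               * (256 * a ^+ 3 + 368 * a ^+ 2 + 104 * a + 23)).
Proof. by move=> h1 h2 h3; rewrite /wdisc; field; rewrite h1 h2 h3. Qed.

Lemma E222_PQ_gen (F : fieldType) (a x : F) :
  13 != 0 :> F -> 169 != 0 :> F -> 2197 != 0 :> F ->
  x = - (262 / 13) \/ x = - (366 / 13) ->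
  (32 * a + 8) ^+ 2 = x ^+ 3 + (16 * a + 942 / 13) * x ^+ 2
    + (10048%:R / 13 * a + 293084%:R / 169) * x
    + (1024 * a ^+ 2 + 1620800%:R / 169 * a + 30250696%:R / 2197).
Proof. by move=> h1 h2 h3 [] ->; field; rewrite h1 h2 h3. Qed.

Lemma E222_wdisc : wdisc E222_a2 E222_a4 E222_a6 =
  - 2 ^+ 16 * ((4 * a_ + 1) ^+ 2
               * (256 * a_ ^+ 3 + 368 * a_ ^+ 2 + 104 * a_ + 23)).
Proof. by apply: E222_wdisc_gen; apply: Qa_natr_neq0. Qed.

Lemma E222_disc_neq0 : wdisc E222_a2 E222_a4 E222_a6 != 0.
Proof.
rewrite E222_wdisc; apply: mulf_neq0.
  by rewrite oppr_eq0 expf_neq0 ?Qa_natr_neq0.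
apply: mulf_neq0; last exact: (@Qa_cubic_neq0 256 368 104 23).
apply: expf_neq0; have := @Qa_poly_neq0 4 1 isT.
by rewrite rmorph_nat.
Qed.

Definition E222 : ecurve Qa := ECurve E222_disc_neq0.

Lemma oncurve_P222 : oncurve E222 (Some (- (262 / 13), 32 * a_ + 8)).
Proof.
by apply/eqP/E222_PQ_gen; rewrite ?Qa_natr_neq0 //; left.
Qed.

Lemma oncurve_Q222 : oncurve E222 (Some (- (366 / 13), 32 * a_ + 8)).
Proof.
by apply/eqP/E222_PQ_gen; rewrite ?Qa_natr_neq0 //; right.
Qed.

Definition P222 : point E222 := Point oncurve_P222.
Definition Q222 : point E222 := Point oncurve_Q222.

(* Main.v *)
(**
  The substitution x = 4u - 314/13, y = 8v, t = 4a turns E222 into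
  v^2 = f(u) with f = (u^2 - 1)(u + t) + (t + 1)^2, where P = (1, t + 1) and
  Q = (-1, t + 1).  This equation is quadratic in t: with
  p = 2v - 2t - u^2 - 1 and q = 2v + 2t + u^2 + 1 the surface becomes
  p q = - (u - 1)^2 (u + 1) (u - 3), and t is a rational function of (u, p).
  Hence its coordinate ring becomes the factorial ring k[u, p, 1/p] once p is
  inverted, and the zeros of p on the curve are P (twice), Q and
  (3, t + 5) = - 2P - Q.

  Generation: a point S = (u0, v0) over k(a), u0 not constant, is a zero of
  Phi(u, p) = X(a) - u D(a), where u0 = X/D and a is expressed in u and p.
  The divisor of Phi on the affine curve is S + (-S), and the gcd in k[u][p]
  with the analogous function built from p(S) splits off a factor g vanishing
  at S and not at -S.  Besides S, all zeros of g lie on p q = 0, and adding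
  them to S one at a time along chords shows S in <P, Q>.

  Independence: there is no 2-torsion and P, Q, P + Q are not doubles, because
  the slope of a tangent through one of their opposites satisfies a monic
  quartic over k[a], which a degree count excludes.
*)
Require Import Defs.
From mathcomp Require Import all_boot all_order all_algebra.
From HB Require Import structures.
From mathcomp Require Import generic_quotient ring zify.
From Stdlib Require Import Classical.

Set Implicit Arguments.
Unset Strict Implicit.
Unset Printing Implicit Defensive.

Import GRing.Theory.
Local Open Scope ring_scope.

Local Notation "x %:F" := (tofrac x).

(** * Gauss' lemma for [k[u][p]] *)

Section PolyField.
Variable k : fieldType.
Implicit Types (p q b : {poly k}) (g h F : {poly {poly k}}).

Lemma irreducible_divisor p : (1 < size p)%N ->
  exists2 q, irreducible_poly q & q %| p.
Proof.
have [n] := ubnP (size p); elim: n p => // n IHn p /ltnSE sp p1.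
have [[q []]|noq] :=
    classic (exists q, [/\ (1 < size q)%N, (size q < size p)%N & q %| p]).
  move=> q1 qp dvd; have [r irr_r dvdr] := IHn q (leq_trans qp sp) q1.
  by exists r => //; apply: dvdp_trans dvd.
exists p; rewrite ?dvdpp //; split=> // q q1 dvdq.
have p0 : p != 0 by rewrite -size_poly_gt0 ltnW.
rewrite -dvdp_size_eqp // eqn_leq dvdp_leq //= leqNgt.
apply/negP => sq; apply: noq; exists q; split=> //.
rewrite ltn_neqAle eq_sym q1 lt0n size_poly_eq0.
by apply: contraTneq dvdq => ->; rewrite dvd0p.
Qed.

Lemma irreducible_dvdM q p1 p2 :
  irreducible_poly q -> q %| p1 * p2 -> (q %| p1) || (q %| p2).
Proof.
move=> irr_q; have [//|ndvd1] := boolP (q %| p1).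
by rewrite Gauss_dvdpr // irreducible_poly_coprime.
Qed.

Lemma scalep_dvd_coef q g : (forall i, q %| g`_i) -> exists h, g = q *: h.
Proof.
move=> dvd; exists (\poly_(i < size g) (g`_i %/ q)); apply/polyP => i.
rewrite coefZ coef_poly; case: ltnP => [_|si].
  by rewrite mulrC divpK.
by rewrite mulr0 nth_default.
Qed.

Lemma irreducible_dvd_coefM q g h : irreducible_poly q ->
  (forall i, q %| (g * h)`_i) ->
  (forall i, q %| g`_i) \/ (forall i, q %| h`_i).
Proof.
move=> irr_q dvd; apply: NNPP => /not_or_and[ng nh].
have min_coef F : ~ (forall i, q %| F`_i) ->
    exists2 i, ~~ (q %| F`_i) & forall j, (j < i)%N -> q %| F`_j.
  move=> /not_all_ex_not[i /negP ni].
  have ex : exists i, ~~ (q %| F`_i) by exists i.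
  case: (ex_minnP ex) => m nm minm; exists m => // j; rewrite ltnNge.
  by apply: contraNT => /minm.
have [[i ni li] [j nj lj]] := (min_coef _ ng, min_coef _ nh).
have := dvd (i + j)%N; rewrite coefM.
have ij : (i < (i + j).+1)%N by rewrite ltnS leq_addr.
rewrite (bigD1 (Ordinal ij)) //= addKn dvdp_addl.
  by move/(irreducible_dvdM irr_q); rewrite (negPf ni) (negPf nj).
apply: (big_ind (fun x => q %| x)) => [|x y|[s sij]];
  [exact: dvdp0 | exact: dvdp_add |].
rewrite -val_eqE /= => si; have [lt_si|le_is] := ltnP s i.
  by apply/dvdp_mulr/li.
apply/dvdp_mull/lj; rewrite ltn_subLR; last by rewrite -ltnS.
by rewrite ltn_add2r ltn_neqAle eq_sym si.
Qed.

Lemma scalep_eq_mulp b F g h : b != 0 -> b *: F = g * h ->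
  exists b1 b2 g1 h1, [/\ b1 != 0, g = b1 *: g1, h = b2 *: h1 & F = g1 * h1].
Proof.
have [n] := ubnP (size b); elim: n b g h => // n IHn b g h /ltnSE sb b0 e.
have [/size1_polyC eb|] := leqP (size b) 1.
  have c0 : b`_0 != 0 by apply: contraNneq b0 => c0; rewrite eb c0.
  move: (b`_0) eb c0 e => c -> c0 e; exists 1, c%:P, g, (c^-1%:P *: h).
  split; rewrite ?oner_neq0 ?scale1r //.
    by rewrite scalerA -polyCM mulfV // scale1r.
  by rewrite -scalerAr -e scalerA -polyCM mulVf // scale1r.
move=> /irreducible_divisor[q irr_q /dvdpP[b' eb]].
have q0 := irredp_neq0 irr_q.
have b'0 : b' != 0 by apply: contraNneq b0; rewrite eb => ->; rewrite mul0r.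
have sb' : (size b' < n)%N.
  apply: leq_trans sb; rewrite eb size_mul //; case: (irr_q) => q1 _.
  by case: (size q) q1 => [|[|m]] //= _; rewrite !addnS /= ltnS leq_addr.
have cancel_q F' F'' : q *: F' = q *: F'' -> F' = F''.
  by rewrite -!mul_polyC => /mulfI -> //; rewrite polyC_eq0.
have dvd i : q %| (g * h)`_i.
  by rewrite -e eb coefZ -mulrA dvdp_mull ?dvdp_mulIl.
have [/scalep_dvd_coef[g' eg]|/scalep_dvd_coef[h' eh]] :=
    irreducible_dvd_coefM irr_q dvd.
  have e' : b' *: F = g' * h.
    by apply: cancel_q; rewrite scalerAl -eg -e scalerA mulrC -eb.
  have [b1 [b2 [g1 [h1 [b10 eg1 eh1 eF]]]]] := IHn _ _ _ sb' b'0 e'.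
  exists (q * b1), b2, g1, h1; split=> //; first exact: mulf_neq0.
  by rewrite eg eg1 scalerA.
have e' : b' *: F = g * h'.
  by apply: cancel_q; rewrite scalerAr -eh -e scalerA mulrC -eb.
have [b1 [b2 [g1 [h1 [b10 eg1 eh1 eF]]]]] := IHn _ _ _ sb' b'0 e'.
by exists b1, (q * b2), g1, h1; split=> //; rewrite eh eh1 scalerA.
Qed.

Lemma separating_factor (L : fieldType)
    (phi1 phi2 : {rmorphism {poly {poly k}} -> L}) F F' :
  (forall b, b != 0 -> phi1 b%:P != 0) ->
  (forall b, b != 0 -> phi2 b%:P != 0) ->
  phi1 F = 0 -> phi2 F = 0 -> phi1 F' = 0 -> phi2 F' != 0 ->
  exists g h, [/\ F = g * h, phi1 g = 0 & phi2 h = 0].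
Proof.
move=> inj1 inj2 F1 F2 F'1 F'2.
have [[u v] /= /eqpP[[c d] /= /andP[c0 d0] ebez]] := Bezoutp F F'.
have [[b h] /= b0 eh] := Pdiv.Idomain.dvdpP _ _ (dvdp_gcdl F F').
have [[b' h'] /= b'0 eh'] := Pdiv.Idomain.dvdpP _ _ (dvdp_gcdr F F').
have g1 : phi1 (gcdp F F') = 0.
  apply: (mulfI (inj1 d d0)); rewrite mulr0 -rmorphM mul_polyC -ebez.
  by rewrite -mul_polyC !(rmorphM, rmorphD) /= F1 F'1 !(mulr0, addr0).
have g2 : phi2 (gcdp F F') != 0.
  apply: contraNneq (mulf_neq0 (inj2 b' b'0) F'2) => g2.
  by rewrite -rmorphM mul_polyC eh' rmorphM g2 mulr0.
rewrite mulrC in eh.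
have [b1 [b2 [g [f [b10 eg ef eF]]]]] := scalep_eq_mulp b0 eh.
exists g, f; split=> //.
  apply: (mulfI (inj1 b1 b10)); rewrite mulr0 -rmorphM mul_polyC.
  by rewrite -eg.
have g2' : phi2 g != 0.
  by apply: contraNneq g2; rewrite eg -mul_polyC rmorphM => ->; rewrite mulr0.
by apply: (mulfI g2'); rewrite -rmorphM -eF F2 mulr0.
Qed.

End PolyField.

(** * Rational functions *)

Lemma fracP (R : idomainType) (z : {fraction R}) :
  exists2 nd, nd.2 != 0 & z = nd.1%:F / nd.2%:F.
Proof.
elim/quotW: z => x; exists (frac x); first exact: denom_ratioP.
apply: (canRL (mulfK _)); first by rewrite tofrac_eq0 denom_ratioP.
unlock tofrac; rewrite -[LHS]FracField.pi_mul; apply/eqmodP.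
rewrite /= FracField.equivfE /FracField.mulf.
by rewrite !numden_Ratio ?(oner_neq0, mulf_neq0, denom_ratioP, mulr1) // mulrC.
Qed.

Section RationalFunctions.
Variable k : fieldType.
Implicit Types (X D p : {poly k}) (z : {fraction {poly k}}).
Notation K := {fraction {poly k}}.

Lemma frac_coprimeP z :
  exists X D, [/\ coprimep X D, D != 0 & z = X%:F / D%:F].
Proof.
have [[n d] /= d0 ->] := fracP z; have g0 : gcdp n d != 0.
  by rewrite gcdp_eq0 negb_and d0 orbT.
exists (n %/ gcdp n d), (d %/ gcdp n d); split.
- by rewrite coprimep_div_gcd // d0 orbT.
- by rewrite dvdp_div_eq0 ?dvdp_gcdr.
apply/eqP; rewrite eqr_div ?tofrac_eq0 ?dvdp_div_eq0 ?dvdp_gcdr //.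
rewrite -!tofracM tofrac_eq; apply/eqP/(mulIf g0).
by rewrite -mulrA (divpK (dvdp_gcdr n d)) mulrAC (divpK (dvdp_gcdl n d)).
Qed.

Lemma frac_root_lead (q : {poly {poly k}}) X D : coprimep X D -> D != 0 ->
  root (map_poly (@tofrac {poly k}) q) (X%:F / D%:F) -> D %| lead_coef q.
Proof.
move=> cop D0 /rootP; have D0' : D%:F != 0 by rewrite tofrac_eq0.
have [->|q0] := eqVneq q 0; first by rewrite lead_coef0 dvdp0.
rewrite horner_coef size_map_inj_poly ?rmorph0 //; last first.
  by move=> x y /eqP; rewrite tofrac_eq => /eqP.
rewrite /lead_coef.
case: (size q) (size_poly_gt0 q) => [|n]; first by rewrite q0.
move=> _ /(congr1 ( *%R^~ (D ^+ n)%:F)); rewrite mul0r big_distrl /=.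
have e (i : 'I_n.+1) :
    (map_poly (@tofrac {poly k}) q)`_i * (X%:F / D%:F) ^+ i * (D ^+ n)%:F =
    (q`_i * X ^+ i * D ^+ (n - i))%:F.
  have le_in : (i <= n)%N by rewrite -ltnS.
  rewrite coef_map /= !tofracM !tofracXn expr_div_n.
  have -> : D%:F ^+ n = D%:F ^+ i * D%:F ^+ (n - i) by rewrite -exprD subnKC.
  by rewrite !mulrA divfK ?expf_neq0.
rewrite (eq_bigr _ (fun i _ => e i)) -rmorph_sum => /eqP; rewrite tofrac_eq0.
rewrite big_ord_recr /= subnn expr0 mulr1 addrC addr_eq0 => /eqP h.
rewrite -(@Gauss_dvdpl _ _ (X ^+ n)) ?coprimep_expr 1?coprimep_sym // h.
rewrite dvdpNr; apply: (big_ind (fun x => D %| x)) => [|x y|i _];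
  [exact: dvdp0 | exact: dvdp_add |].
by rewrite dvdp_mull // dvdp_exp // subn_gt0.
Qed.

Lemma frac_denom1 X D : D != 0 -> D %| 1 -> exists p, X%:F / D%:F = p%:F.
Proof.
move=> D0; rewrite dvdp1 => /size_poly1P[c c0 ->]; exists (c^-1 *: X).
apply: (canLR (mulfK _)); first by rewrite tofrac_eq0 polyC_eq0.
by rewrite -tofracM mulrC mul_polyC scalerA mulfV // scale1r.
Qed.

Lemma frac_integral (n : nat) (c : nat -> {poly k}) z :
  z ^+ n + \sum_(i < n) (c i)%:F * z ^+ i = 0 -> exists p, z = p%:F.
Proof.
have [X [D [cop D0 ->]]] := frac_coprimeP z => e.
apply: (frac_denom1 _ D0).
have -> : 1 = lead_coef ('X^n + \poly_(i < n) c i).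
  by rewrite lead_coefDl ?lead_coefXn // size_polyXn ltnS size_poly.
apply: frac_root_lead cop D0 _; apply/rootP.
rewrite rmorphD /= map_polyXn hornerD hornerXn -[RHS]e; congr (_ + _).
rewrite poly_def rmorph_sum horner_sum; apply: eq_bigr => i _.
by rewrite /= -mul_polyC rmorphM /= map_polyC map_polyXn !hornerE.
Qed.

Lemma frac_algebraic (b : {poly k}) z : b != 0 ->
  root (map_poly (@tofrac {poly k} \o polyC) b) z -> exists c, z = c%:P%:F.
Proof.
have [X [D [cop D0 ->]]] := frac_coprimeP z => b0 rb.
have [|p ep] := frac_denom1 X D0.
  have : root (map_poly (@tofrac {poly k}) (map_poly polyC b)) (X%:F / D%:F).
    by rewrite -map_poly_comp.
  move/(frac_root_lead cop D0).
  rewrite lead_coef_map_inj //; last exact: polyC_inj.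
  by move/dvdp_trans; apply; rewrite dvdp1 size_polyC lead_coef_eq0 b0.
move: rb; rewrite ep => /rootP.
rewrite map_poly_comp horner_map /= => /eqP; rewrite tofrac_eq0 => rb.
have : (size p <= 1)%N.
  rewrite leqNgt; apply/negP => sp; move: rb; rewrite -[_.[p]]/(b \Po p).
  by rewrite comp_poly_eq0 // (negPf b0).
by move/size1_polyC => ->; exists p`_0.
Qed.

End RationalFunctions.

(** * Functions on the affine curve *)

(* [(a, b)] stands for [a + b * sqrt d]. *)
Definition qext (R : comNzRingType) (d : R) : Type := (R * R)%type.

Section QuadraticExtension.
Variables (R : comNzRingType) (d : R).
Notation W := (qext d).

HB.instance Definition _ := GRing.Zmodule.copy W (R * R)%type.

Definition qext_mul (x y : W) : W :=
  (x.1 * y.1 + d * (x.2 * y.2), x.1 * y.2 + x.2 * y.1).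

Definition qextC (a : R) : W := (a, 0).

Lemma qext_mulA : associative qext_mul.
Proof. by move=> x y z; congr (_, _); rewrite /=; ring. Qed.

Lemma qext_mulC : commutative qext_mul.
Proof. by move=> x y; congr (_, _); rewrite /=; ring. Qed.

Lemma qext_mul1 : left_id (qextC 1) qext_mul.
Proof. by case=> a b; congr (_, _); rewrite /=; ring. Qed.

Lemma qext_mulDl : left_distributive qext_mul +%R.
Proof. by move=> x y z; congr (_, _); rewrite /=; ring. Qed.

Lemma qext_one_neq0 : qextC 1 != 0.
Proof. by apply/eqP => -[/eqP]; rewrite oner_eq0. Qed.

HB.instance Definition _ := GRing.Zmodule_isComNzRing.Build W
  qext_mulA qext_mulC qext_mul1 qext_mulDl qext_one_neq0.

Lemma qextC_zmod : zmod_morphism qextC.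
Proof. by move=> a b; congr (_, _); rewrite /= subr0. Qed.

Lemma qextC_monoid : monoid_morphism qextC.
Proof. by split=> [//|a b]; congr (_, _); rewrite /=; ring. Qed.

HB.instance Definition _ := GRing.isZmodMorphism.Build R W qextC qextC_zmod.
HB.instance Definition _ := GRing.isMonoidMorphism.Build R W qextC qextC_monoid.

Definition qnorm (x : W) : R := x.1 ^+ 2 - d * x.2 ^+ 2.

Lemma qnormM : {morph qnorm : x y / x * y}.
Proof. by case=> a b [a' b']; rewrite /qnorm /=; ring. Qed.

Lemma qnormC a : qnorm (qextC a) = a ^+ 2.
Proof. by rewrite /qnorm /=; ring. Qed.

Lemma qnormX x n : qnorm (x ^+ n) = qnorm x ^+ n.
Proof.
elim: n => [|n IHn]; first by rewrite !expr0 qnormC expr1n.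
by rewrite !exprS qnormM IHn.
Qed.

End QuadraticExtension.

Section EvalQext.
Variables (R S : comNzRingType) (d : R) (phi : {rmorphism R -> S}) (s : S).

Definition qeval of s ^+ 2 = phi d := fun x : qext d => phi x.1 + phi x.2 * s.

Hypothesis s2 : s ^+ 2 = phi d.

Lemma qeval_zmod : zmod_morphism (qeval s2).
Proof. by move=> x y; rewrite /qeval !rmorphB /=; ring. Qed.

Lemma qeval_monoid : monoid_morphism (qeval s2).
Proof.
split=> [|x y]; first by rewrite /qeval /= rmorph0 rmorph1; ring.
by rewrite /qeval /= !rmorphD !rmorphM -s2; ring.
Qed.

HB.instance Definition _ :=
  GRing.isZmodMorphism.Build (qext d) S (qeval s2) qeval_zmod.
HB.instance Definition _ :=
  GRing.isMonoidMorphism.Build (qext d) S (qeval s2) qeval_monoid.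

End EvalQext.

Lemma size_qnorm_neq2 (K : fieldType) (f : {poly K}) (x : qext f) :
  size f = 4%N -> size (qnorm x) != 2%N.
Proof.
move=> sf; rewrite /qnorm; move: (x.1 : {poly K}) (x.2 : {poly K}) => a b {x}.
have sz2 (p : {poly K}) : p != 0 -> size (p ^+ 2) = (size p).*2.-1.
  by move=> p0; rewrite expr2 size_mul // -addnn.
have f0 : f != 0 by rewrite -size_poly_gt0 sf.
have [->|b0] := eqVneq b 0.
  rewrite expr0n /= mulr0 subr0; have [->|a0] := eqVneq a 0.
    by rewrite expr0n size_poly0.
  by rewrite sz2 //; apply/eqP; lia.
have sb : size (f * b ^+ 2) = (size b).*2.+2.
  rewrite size_mul ?expf_neq0 // sf sz2 //.
  by have := b0; rewrite -size_poly_gt0; lia.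
have sb0 : (0 < size b)%N by rewrite size_poly_gt0.
have [->|a0] := eqVneq a 0.
  by rewrite expr0n /= sub0r size_polyN sb; apply/eqP; lia.
have sa0 : (0 < size a)%N by rewrite size_poly_gt0.
have sa := sz2 a a0.
have [l|l] := ltnP (size (a ^+ 2)%R) (size (f * b ^+ 2)%R).
  by rewrite addrC size_polyDl ?size_polyN // sb; apply/eqP; lia.
rewrite size_polyDl ?size_polyN; first by rewrite sa; apply/eqP; lia.
by rewrite ltn_neqAle l andbT sa sb; apply/eqP; lia.
Qed.

Section PointsFromFunctions.
Variables (K : fieldType) (t : K) (E : ecurve K).
Hypotheses (a2E : ec_a2 E = t) (a4E : ec_a4 E = -1)
           (a6E : ec_a6 E = t ^+ 2 + t + 1).
Implicit Types (S T : point E) (u v : K).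

Definition fcub : {poly K} :=
  ('X ^+ 2 - 1) * ('X + t%:P) + ((t + 1) ^+ 2)%:P.

Lemma fcubE u : fcub.[u] = (u ^+ 2 - 1) * (u + t) + (t + 1) ^+ 2.
Proof. by rewrite /fcub !hornerE. Qed.

Lemma size_fcub : size fcub = 4%N.
Proof.
rewrite /fcub size_polyDl; rewrite size_mul -?size_poly_eq0 ?size_XnsubC //
  ?size_XaddC //.
by rewrite (leq_ltn_trans (size_polyC_leq1 _)).
Qed.

Lemma oncurveE u v : oncurve E (Some (u, v)) = (v ^+ 2 == fcub.[u]).
Proof. by rewrite /oncurve a2E a4E a6E fcubE; congr (_ == _); ring. Qed.

Lemma point_fcub S u v : point_val S = Some (u, v) -> v ^+ 2 = fcub.[u].
Proof. by move=> e; apply/eqP; rewrite -oncurveE -e point_on. Qed.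

Lemma point_exists u v : v ^+ 2 = fcub.[u] ->
  exists S : point E, point_val S = Some (u, v).
Proof. by move/eqP; rewrite -oncurveE => h; exists (Point h). Qed.

Lemma point_add_chord S T x1 y1 x2 y2 s :
  point_val S = Some (x1, y1) -> point_val T = Some (x2, y2) ->
  x1 != x2 -> y1 - y2 = s * (x1 - x2) ->
  let x3 := s ^+ 2 - t - x1 - x2 in
  point_val (S + T) = Some (x3, s * (x1 - x3) - y1).
Proof.
move=> e1 e2 nx es x3; have d : x1 - x2 != 0 by rewrite subr_eq0.
rewrite [LHS]/(raw_add E (point_val S) (point_val T)) e1 e2 /raw_add /slope.
by rewrite (negPf nx) /= es mulfK // a2E.
Qed.

(* [- p q], see [qnorm_pelt] *)
Definition branch_poly : {poly K} :=
  ('X - 1%:P) ^+ 2 * ('X - (-1)%:P) * ('X - 3%:P).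

Definition branch : seq K := [:: 1; -1; 3].

Lemma dvd_branch_root (M : {poly K}) n :
  M %| branch_poly ^+ n -> size M != 1%N ->
  exists2 c, c \in branch & root M c.
Proof.
move=> dvd sM; have [/hasP[c cb rc]|] := boolP (has (root M) branch).
  by exists c.
rewrite /= orbF !negb_or => /and3P[r1 r2 r3]; case/negP: sM.
rewrite -dvdp1 -(@Gauss_dvdpl _ _ (branch_poly ^+ n)) ?mul1r //.
by apply: coprimep_expr; rewrite /branch_poly !coprimepMr !coprimep_XsubC r1 r2.
Qed.

Variable G : point E -> Prop.
Hypothesis GB : forall S T, G S -> G T -> G (S - T).
Hypothesis G_branch :
  forall S u v, point_val S = Some (u, v) -> u \in branch -> G S.

(* Dividing [x] times the line through [-S] and [-T], where [T] is a zero of [x]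
   with abscissa in [branch], by the equations of the two vertical lines
   replaces the zeros [S] and [T] by the single zero [S + T]. *)
Lemma mem_of_split_norm (x : qext fcub) (M : {poly K}) n S u v :
  point_val S = Some (u, v) -> x.1.[u] + x.2.[u] * v = 0 ->
  qnorm x = ('X - u%:P) * M -> M %| branch_poly ^+ n -> M != 0 -> G S.
Proof.
have [N] := ubnP (size M).
elim: N x M S u v => // N IHN [a b] M S u v /ltnSE sM.
move=> eS /= x0 nx dvdM M0.
have [ub|nub] := boolP (u \in branch); first exact: G_branch eS ub.
have sM1 : size M != 1%N.
  apply: contraNneq (size_qnorm_neq2 (a, b) size_fcub) => sM1.
  by rewrite nx size_mul ?polyXsubC_eq0 // size_XsubC sM1.
have [c cb /factor_theorem[M' eM]] := dvd_branch_root dvdM sM1.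
have uc : u != c by apply: contraNneq nub => ->.
have uc' : u - c != 0 by rewrite subr_eq0.
have M'0 : M' != 0 by apply: contraNneq M0; rewrite eM => ->; rewrite mul0r.
have sXc (p : {poly K}) : p != 0 -> size (p * ('X - c%:P)) = (size p).+1.
  by move=> p0; rewrite size_Mmonic ?monicXsubC // size_XsubC addn2.
have sM' : (size M' < N)%N by rewrite -sXc // -eM.
have dvdM' : M' %| branch_poly ^+ n.
  by apply: dvdp_trans dvdM; rewrite eM dvdp_mulIl.
have Xc0 : 'X - c%:P != 0 by rewrite polyXsubC_eq0.
have Xu0 : 'X - u%:P != 0 by rewrite polyXsubC_eq0.
have nc : a.[c] ^+ 2 = b.[c] ^+ 2 * fcub.[c].
  have : (qnorm ((a, b) : qext fcub)).[c] = 0.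
    by rewrite nx eM !hornerM !hornerXsubC subrr !mulr0.
  rewrite /qnorm hornerD hornerN (hornerM fcub) !horner_exp /= => /eqP.
  by rewrite subr_eq0 mulrC => /eqP.
have [bc|bc] := eqVneq b.[c] 0.
  have ac : a.[c] = 0.
    by apply/eqP; rewrite -sqrf_eq0 nc bc expr0n mul0r.
  have [a' ea] := factor_theorem _ _ (introT rootP ac).
  have [b' eb] := factor_theorem _ _ (introT rootP bc).
  have nx' : qnorm ((a', b') : qext fcub) * ('X - c%:P) = ('X - u%:P) * M'.
    apply: (mulIf Xc0); rewrite -[RHS]mulrA -eM -nx ea eb /qnorm /=; ring.
  have /factor_theorem[M'' eM'] : root M' c.
    have := congr1 (horner^~ c) nx'; rewrite !hornerM !hornerXsubC subrr mulr0.
    by move/esym/eqP; rewrite mulf_eq0 -opprB oppr_eq0 (negPf uc').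
  have M''0 : M'' != 0.
    by apply: contraNneq M'0; rewrite eM' => ->; rewrite mul0r.
  apply: (IHN (a', b') M'' S u v) => //.
  - by rewrite ltnW // -sXc // -eM'.
  - move: x0; rewrite ea eb /= !hornerM !hornerXsubC => /eqP.
    rewrite mulrAC -mulrDl mulf_eq0 (negPf uc') orbF => /eqP //.
  - by apply: (mulIf Xc0); rewrite nx' eM' mulrA.
  - by apply: dvdp_trans dvdM'; rewrite eM' dvdp_mulIl.
pose v1 := - (a.[c] / b.[c]).
have v1f : v1 ^+ 2 = fcub.[c].
  by rewrite /v1 sqrrN expr_div_n nc mulrC mulKf // sqrf_eq0.
have [T eT] := point_exists v1f.
pose s := (v - v1) / (u - c).
have es : v - v1 = s * (u - c) by rewrite /s divfK.
have := point_add_chord eS eT uc es; set u3 := _ - _ - _ - _ => eU.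
have h0 := point_fcub eS; have h1 : s * (v + v1) =
    u ^+ 2 + u * c + c ^+ 2 + t * (u + c) - 1.
  apply: (mulfI uc'); rewrite mulrCA mulrA -es.
  have -> : (v - v1) * (v + v1) = v ^+ 2 - v1 ^+ 2 by ring.
  by rewrite v1f h0 !fcubE; ring.
pose m := s%:P * ('X - u%:P) + v%:P.
pose D := ('X - u%:P) * ('X - c%:P); have D0 : D != 0 by apply: mulf_neq0.
have mf : m ^+ 2 - fcub = - (D * ('X - u3%:P)).
  apply/eqP; rewrite -subr_eq0 opprK; apply/eqP.
  transitivity (('X - u%:P) *
      (s * (v + v1) - (u ^+ 2 + u * c + c ^+ 2 + t * (u + c) - 1))%:P +
      (v ^+ 2 - fcub.[u])%:P); last by rewrite h0 h1 !subrr mulr0 addr0.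
  have -> : v1 = v - s * (u - c) by rewrite -es; ring.
  rewrite fcubE /m /D /fcub /u3.
  rewrite !(polyCB, polyCD, polyCM, rmorphXn, polyC1, polyCN) /=.
  move: (u%:P) (v%:P) (c%:P) (s%:P) (t%:P) => uP vP cP sP tP; ring.
have rm1 : (a + b * m).[u] = 0.
  by rewrite /m hornerD hornerM !hornerE subrr mulr0 add0r.
have rm2 : (a + b * m).[c] = 0.
  rewrite /m hornerD !hornerE -[c - u]opprB mulrN -es.
  by rewrite opprB subrK /v1 mulrN mulrC divfK // subrr.
have [q1 eq1] := factor_theorem _ _ (introT rootP rm2).
have /factor_theorem[b' eb'] : root q1 u.
  move: rm1; rewrite eq1 hornerM hornerXsubC => /eqP.
  by rewrite mulf_eq0 (negPf uc') orbF.
have eD : a + b * m = b' * D by rewrite eq1 eb' /D mulrA.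
pose a' := m * b' + b * ('X - u3%:P).
have eD' : a * m + b * fcub = a' * D.
  have -> : a * m + b * fcub = m * (a + b * m) - b * (m ^+ 2 - fcub) by ring.
  by rewrite eD mf /a'; ring.
suff GU : G (S + T) by have := GB GU (G_branch eT cb); rewrite addrK.
apply: (IHN (a', b') (- M') (S + T) u3 _ _ eU) => /=.
- by rewrite size_polyN.
- by rewrite /a' /m !hornerE; ring.
- apply: (mulIf (expf_neq0 2 D0)).
  have -> : qnorm ((a', b') : qext fcub) * D ^+ 2 =
      (a' * D) ^+ 2 - fcub * (b' * D) ^+ 2 by rewrite /qnorm /=; ring.
  rewrite -eD -eD'.
  have -> : (a * m + b * fcub) ^+ 2 - fcub * (a + b * m) ^+ 2 =
      qnorm ((a, b) : qext fcub) * (m ^+ 2 - fcub) by rewrite /qnorm /=; ring.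
  by rewrite nx mf eM /D; ring.
- by rewrite dvdpNl.
- by rewrite oppr_eq0.
Qed.

End PointsFromFunctions.

(** * Factorization on the conic bundle *)

(* [16 a p] in terms of [u] and [p] *)
Definition affine_t (R : pzRingType) (u p : R) : R :=
  - ((u - 1) ^+ 2 * (u + 1) * (u - 3)) - p ^+ 2 - 2 * p * (u ^+ 2 + 1).

Lemma rmorph_affine_t (R S : comNzRingType) (phi : {rmorphism R -> S})
    (u p : R) :
  phi (affine_t u p) = affine_t (phi u) (phi p).
Proof. by rewrite /affine_t; ring. Qed.

(* [p = 2 v - 2 t - u ^ 2 - 1] *)
Definition pelt (L : fieldType) (t : L) : qext (fcub t) :=
  (- ('X ^+ 2 + (2 * t + 1)%:P), 2).

Lemma affine_t_pelt (L : fieldType) (a : L) :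
  affine_t (qextC (fcub (4 * a)) 'X) (pelt (4 * a)) =
  16 * (qextC _ a%:P * pelt (4 * a)).
Proof.
have nat n : n%:R = qextC (fcub (4 * a)) n%:R by rewrite rmorph_nat.
rewrite /affine_t (nat 16) (nat 3) (nat 2) /pelt.
apply: injective_projections; rewrite /= /fcub.
  by ring.
by ring.
Qed.

Lemma qnorm_pelt (L : fieldType) (t : L) : qnorm (pelt t) = branch_poly L.
Proof.
by rewrite /qnorm /pelt /branch_poly /= /fcub; ring.
Qed.

Section ConicBundle.
Variables (k K : fieldType) (phi : {rmorphism {poly k} -> K}).
Hypotheses (char_neq2 : 2 != 0 :> k)
  (phi_neq0 : forall X, X != 0 -> phi X != 0)
  (phi_frac : forall z, exists X D, D != 0 /\ z = phi X / phi D).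
Notation a := (phi 'X).
Notation t := (4 * a).
Notation f := (fcub t).
Notation W := (qext f).
Implicit Types (X D b : {poly k}) (G : {poly {poly k}}) (u v : K).

Definition cst : {poly k} -> W := @qextC _ f \o map_poly (phi \o polyC).
HB.instance Definition _ := GRing.RMorphism.on cst.

Definition pW : W := pelt t.

Definition toW : {poly {poly k}} -> W := horner_eval pW \o map_poly cst.
HB.instance Definition _ := GRing.RMorphism.on toW.

Lemma toWC b : toW b%:P = cst b.
Proof. by rewrite /toW /= map_polyC /= /horner_eval hornerC. Qed.

Lemma toWX : toW 'X = pW.
Proof. by rewrite /toW /= map_polyX /= /horner_eval hornerX. Qed.

Definition tau : {poly {poly k}} := (16^-1)%:P%:P * affine_t 'X%:P 'X.

Lemma toW_tau : toW tau = qextC f a%:P * pW.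
Proof.
have n16 : 16 != 0 :> k.
  have -> : 16 = 2 ^+ 4 :> k by ring.
  exact: expf_neq0.
have e16 : cst (16^-1)%:P * 16 = 1.
  transitivity (cst ((16^-1)%:P * 16%:R)); first by rewrite rmorphM rmorph_nat.
  by rewrite -polyC_natr -polyCM mulVf // rmorph1.
rewrite rmorphM /= rmorph_affine_t /= !toWC toWX.
rewrite -[RHS]mul1r -[in RHS]e16 -mulrA.
congr (_ * _).
have -> : cst 'X = qextC f 'X by rewrite /cst /= map_polyX.
exact: affine_t_pelt.
Qed.

(* the numerator [p ^ n X(tau / p)] of [X(a)] as a function of [u] and [p] *)
Definition hom n X : {poly {poly k}} :=
  \sum_(i < n.+1) (X`_i)%:P%:P * tau ^+ i * 'X ^+ (n - i).

Lemma toW_hom n X : (size X <= n.+1)%N ->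
  toW (hom n X) = pW ^+ n * qextC f (phi X)%:P.
Proof.
move=> sX; have eX : phi X = \sum_(i < n.+1) phi (X`_i)%:P * a ^+ i.
  rewrite -[X in LHS](coefK) poly_def.
  rewrite rmorph_sum /= (big_ord_widen n.+1 (fun i => phi (X`_i *: 'X^i))) //.
  rewrite big_mkcond; apply: eq_bigr => i _; case: ltnP => [_|si].
    by rewrite -mul_polyC rmorphM rmorphXn.
  by rewrite nth_default // rmorph0 mul0r.
rewrite eX !rmorph_sum /= big_distrr; apply: eq_bigr => i _.
have le_in : (i <= n)%N by rewrite -ltnS.
rewrite !rmorphM !rmorphXn /= toW_tau toWX toWC /cst /= map_polyC.
have -> : pW ^+ n = pW ^+ i * pW ^+ (n - i) by rewrite -exprD subnKC.
rewrite exprMn.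
move: (qextC _ (phi _)%:P) (qextC _ a%:P ^+ i) (pW ^+ i) (pW ^+ (n - i)).
by move=> c A P P'; ring.
Qed.

(* [p1 != p2] are the values of [p] at [(u, v)] and [(u, - v)]; the function
   [F] vanishes at both points, and [F'] only at the first one. *)
Lemma vanishing_function u v : v != 0 -> v ^+ 2 = f.[u] -> u \notin branch K ->
  (forall b, b != 0 -> (map_poly (phi \o polyC) b).[u] != 0) ->
  exists (x : W) (M : {poly K}) n, [/\ x.1.[u] + x.2.[u] * v = 0,
    qnorm x = ('X - u%:P) * M, M %| branch_poly K ^+ n & M != 0].
Proof.
move=> v0 ev nub u_transc.
have ev' : (- v) ^+ 2 = f.[u] by rewrite sqrrN.
pose E1 : {rmorphism W -> K} := @qeval _ _ f (horner_eval u) v ev.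
pose E2 : {rmorphism W -> K} := @qeval _ _ f (horner_eval u) (- v) ev'.
have E1C (p : {poly K}) : E1 (qextC f p) = p.[u].
  by rewrite /E1 /= /qeval /= /horner_eval horner0 mul0r addr0.
have E2C (p : {poly K}) : E2 (qextC f p) = p.[u].
  by rewrite /E2 /= /qeval /= /horner_eval horner0 mul0r addr0.
pose p1 := E1 pW; pose p2 := E2 pW.
have char_neq2' : 2 != 0 :> K.
  by rewrite -(rmorph_nat (phi \o polyC)) fmorph_eq0.
have p12 : p1 - p2 != 0.
  have -> : p1 - p2 = 2 ^+ 2 * v.
    rewrite /p1 /p2 /E1 /E2 /= /qeval /= /horner_eval -polyC_natr hornerC; ring.
  by rewrite mulf_neq0 // expf_neq0.
have p2_neq0 : p2 != 0.
  have e : p1 * p2 = (branch_poly K).[u].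
    have e12 (w : W) : E1 w * E2 w = (qnorm w).[u].
      case: w => A B; rewrite /E1 /E2 /qnorm /= /qeval /= /horner_eval.
      rewrite hornerD hornerN (hornerM f) !horner_exp -ev.
      by move: A.[u] B.[u] => A' B'; ring.
    by rewrite /p1 /p2 e12 qnorm_pelt.
  have : p1 * p2 != 0.
    move: nub; rewrite e /branch_poly !inE !negb_or => /and3P[n1 n2 n3].
    by rewrite !hornerM !hornerXsubC !mulf_neq0 ?subr_eq0.
  by rewrite mulf_eq0 negb_or => /andP[].
have [X [D [D0 eu]]] := phi_frac u.
have [Y [D' [D'0 ep1]]] := phi_frac p1.
have eX : phi X = u * phi D by rewrite eu divfK // phi_neq0.
have eY : phi Y = p1 * phi D' by rewrite ep1 divfK // phi_neq0.
pose n := maxn (size X) (size D); pose m := maxn (size Y) (size D').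
pose F := hom n X - 'X%:P * hom n D; pose F' := hom m Y - 'X * hom m D'.
have eF : toW F = pW ^+ n * qextC f (- ((phi D)%:P * ('X - u%:P))).
  have cX : cst 'X = qextC f 'X by rewrite /cst /= map_polyX.
  rewrite rmorphB rmorphM /= toWC !toW_hom ?leqW ?leq_maxl ?leq_maxr // cX.
  rewrite eX mulrCA -mulrBr -rmorphM -rmorphB /= polyCM.
  by congr (_ * qextC _ _); ring.
have eF' : toW F' = pW ^+ m * (qextC f (phi Y)%:P - pW * qextC f (phi D')%:P).
  rewrite rmorphB rmorphM /= toWX !toW_hom ?leqW ?leq_maxl ?leq_maxr //.
  by rewrite mulrCA -mulrBr.
have E1b b : b != 0 -> (E1 \o toW) b%:P != 0.
  by move=> b0; rewrite /comp toWC /cst E1C u_transc.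
have E2b b : b != 0 -> (E2 \o toW) b%:P != 0.
  by move=> b0; rewrite /comp toWC /cst E2C u_transc.
have [g [h [eFgh g1 h2]]] : exists g h,
    [/\ F = g * h, (E1 \o toW) g = 0 & (E2 \o toW) h = 0].
  apply: (separating_factor (F' := F') E1b E2b).
  - rewrite -[LHS]/(E1 (toW F)) eF rmorphM E1C.
    by rewrite !hornerE subrr mulr0 oppr0 mulr0.
  - rewrite -[LHS]/(E2 (toW F)) eF rmorphM E2C.
    by rewrite !hornerE subrr mulr0 oppr0 mulr0.
  - rewrite -[LHS]/(E1 (toW F')) eF' rmorphM rmorphB rmorphM !E1C.
    by rewrite !hornerC eY subrr mulr0.
  - rewrite -[X in X != 0]/(E2 (toW F')) eF' rmorphM rmorphB rmorphM !E2C.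
    rewrite !hornerC eY -mulrBl.
    by rewrite rmorphXn !mulf_neq0 ?expf_neq0 ?phi_neq0.
have root_norm (w : W) s : s ^+ 2 = f.[u] -> w.1.[u] + w.2.[u] * s = 0 ->
    root (qnorm w) u.
  move=> es e; apply/rootP; rewrite /qnorm hornerD hornerN (hornerM f).
  rewrite !horner_exp -es.
  have -> : w.1.[u] = - (w.2.[u] * s) by apply/eqP; rewrite -addr_eq0 e.
  by ring.
have [M1 eM1] := factor_theorem _ _ (root_norm _ _ ev g1).
have [M2 eM2] := factor_theorem _ _ (root_norm _ _ ev' h2).
have Xu0 : 'X - u%:P != 0 by rewrite polyXsubC_eq0.
have eM : M1 * M2 = (phi D ^+ 2)%:P * branch_poly K ^+ n.
  have : qnorm (toW g) * qnorm (toW h) =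
      branch_poly K ^+ n * ((phi D)%:P * ('X - u%:P)) ^+ 2.
    rewrite -qnormM -rmorphM -eFgh /= eF.
    by rewrite qnormM qnormX qnorm_pelt qnormC sqrrN.
  rewrite eM1 eM2 => e; apply: (mulIf (expf_neq0 2 Xu0)).
  rewrite rmorphXn /=; move: e.
  move: (branch_poly K ^+ n) ((phi D)%:P) ('X - u%:P) => B C Y0 e.
  by transitivity (M1 * Y0 * (M2 * Y0)); [ring | rewrite e; ring].
have B0 : branch_poly K != 0.
  by rewrite /branch_poly !mulf_neq0 ?polyXsubC_eq0.
have DD0 : phi D ^+ 2 != 0 by rewrite expf_neq0 // phi_neq0.
exists (toW g), M1, n; split.
- exact: g1.
- by rewrite eM1 mulrC.
- by rewrite -(dvdpZr _ _ DD0) -mul_polyC -eM dvdp_mulIl.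
- suff : M1 * M2 != 0 by rewrite mulf_eq0 negb_or => /andP[].
  by rewrite eM mulf_neq0 ?polyC_eq0 // expf_neq0.
Qed.
End ConicBundle.

Section IntegralDegree.
Variable k : fieldType.

Lemma size_integral_root (p : {poly k}) n (c : nat -> {poly k}) m d :
  p ^+ n + \sum_(i < n) c i * p ^+ i = 0 ->
  (forall i, (i < n)%N -> (m * (size (c i)).-1 <= (n - i) * d)%N) ->
  (m * (size p).-1 <= d)%N.
Proof.
move=> e sc; rewrite leqNgt; apply/negP => ltd.
have p0 : p != 0 by apply: contraTneq ltd => ->; rewrite size_poly0 muln0.
have n0 : p ^+ n != 0 by rewrite expf_neq0.
move/eqP: e; rewrite addr_eq0 => /eqP e.
suff : (size (\sum_(i < n) c i * p ^+ i)%R < size (p ^+ n))%N.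
  by rewrite e size_polyN ltnn.
rewrite {e}.
rewrite -size_poly_gt0 in n0.
case: (size (p ^+ n)) (size_exp p n) n0 => [|N] //= sN _.
rewrite ltnS; apply: leq_trans (size_sum _ _ _) _; apply/bigmax_leqP => i _.
have [->|ci] := eqVneq (c i) 0; first by rewrite mul0r size_poly0.
rewrite size_mul ?expf_neq0 //.
have := sc i (ltn_ord i); have := size_exp p i.
have : (0 < size (p ^+ i))%N by rewrite size_poly_gt0 expf_neq0.
move: (ltn_ord i) (size (p ^+ i)) => lt_in s s0 es.
have : (0 < size (c i))%N by rewrite size_poly_gt0.
move: (size (c i)) => sci sci0 h.
have : (m * (sci.-1 + (size p).-1 * i) < m * N)%N.
  rewrite sN mulnDr; move: (size p).-1 ltd => e ltd.
  have : ((n - i) * d < (n - i) * (m * e))%N by rewrite ltn_pmul2l ?subn_gt0.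
  have -> : (m * (e * n) = m * (e * i) + (n - i) * (m * e))%N.
    by rewrite -{1}(subnKC (ltnW lt_in)); ring.
  lia.
by rewrite ltn_mul2l -es => /andP[_]; move: sci0 s0; lia.
Qed.

Lemma frac_integral_size n (c : nat -> {poly k}) m d (z : {fraction {poly k}}) :
  z ^+ n + \sum_(i < n) (c i)%:F * z ^+ i = 0 ->
  (forall i, (i < n)%N -> (m * (size (c i)).-1 <= (n - i) * d)%N) ->
  exists2 p, z = p%:F & (m * (size p).-1 <= d)%N.
Proof.
move=> e; have [p ep] := frac_integral e.
move=> sc; exists p => //; apply: size_integral_root sc.
apply/eqP; rewrite -tofrac_eq0 rmorphD rmorph_sum rmorphXn /= -ep.
rewrite -[X in _ == X]e; apply/eqP; congr (_ + _); apply: eq_bigr => i _.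
by rewrite rmorphM rmorphXn /= -ep.
Qed.
End IntegralDegree.

(** * Points on the curve *)

Lemma size_le2_poly (R : nzRingType) (p : {poly R}) : (size p <= 2)%N ->
  exists c d, p = c%:P * 'X + d%:P.
Proof.
move=> sp; exists p`_1, p`_0; apply/polyP => -[|[|i]];
  rewrite !coefE ?mulr0 ?mulr1.
- by rewrite add0r.
- by rewrite addr0.
- by rewrite addr0 nth_default // (leq_trans sp).
Qed.

Lemma Poly_eq0 (R : nzRingType) (s : seq R) i : Poly s = 0 -> s`_i = 0.
Proof. by move=> e; rewrite -coef_Poly e coef0. Qed.

Lemma size_Poly_pred (R : nzRingType) (s : seq R) :
  ((size (Poly s)).-1 <= (size s).-1)%N.
Proof. by rewrite -!subn1 leq_sub2r ?size_Poly. Qed.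

Section RationalPoints.
Variables (k K : fieldType) (phi : {rmorphism {poly k} -> K}).
Hypotheses (char_neq2 : 2 != 0 :> k)
  (phi_neq0 : forall X, X != 0 -> phi X != 0)
  (phi_integral : forall n (c : nat -> {poly k}) m d z,
     z ^+ n + \sum_(i < n) phi (c i) * z ^+ i = 0 ->
     (forall i, (i < n)%N -> (m * (size (c i)).-1 <= (n - i) * d)%N) ->
     exists2 p, z = phi p & (m * (size p).-1 <= d)%N).
Notation a := (phi 'X).
Notation t := (4 * a).

Let four_neq0 : 4 != 0 :> k.
Proof. by rewrite -[4%N]/(2 * 2)%N natrM mulf_neq0. Qed.

Let phi_eq0 X : phi X = 0 -> X = 0.
Proof. by have [//|/phi_neq0 /eqP] := eqVneq X 0. Qed.

Lemma fcub_neq0 u : (fcub t).[u] != 0.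
Proof.
apply/eqP; rewrite fcubE => e.
pose s : seq {poly k} := [:: Poly [:: 1; 4; 16]; Poly [:: -1]; Poly [:: 0; 4]].
have [||p eu] := @phi_integral 3 (nth 0 s) 1 1 u.
- by rewrite !big_ord_recr big_ord0 -[RHS]e /= !cons_poly_def; ring.
- by case=> [|[|[|]]] // _;
    apply: leq_trans (leq_mul (leqnn _) (size_Poly_pred _)) _.
rewrite mul1n -subn1 leq_subLR => /size_le2_poly[c [d ep]]; rewrite {}ep in eu.
have E : Poly [:: (d ^+ 2 - 1) * d + 1;
    (d ^+ 2 - 1) * (c + 4) + 2 * d ^+ 2 * c + 8;
    2 * d * c * (c + 4) + c ^+ 2 * d + 16; c ^+ 2 * (c + 4)] = 0 :> {poly k}.
  by apply: phi_eq0; rewrite -e eu /= !cons_poly_def; ring.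
have := Poly_eq0 3 E; have := Poly_eq0 2 E; have := Poly_eq0 0 E => /=.
move=> e0 e2 /eqP; rewrite mulf_eq0 expf_eq0 /= addr_eq0.
case/orP=> [/eqP c0|/eqP c4].
  move: e2; rewrite c0 => e2; have /eqP : 4 ^+ 2 = 0 :> k by rewrite -e2; ring.
  by rewrite sqrf_eq0 (negPf four_neq0).
have d1 : d = -1.
  have : 4 ^+ 2 * (d + 1) = 0 by rewrite -e2 c4; ring.
  by move/eqP; rewrite mulf_eq0 sqrf_eq0 (negPf four_neq0) addr_eq0 => /eqP.
have /eqP : 1 = 0 :> k by rewrite -e0 d1; ring.
by rewrite oner_eq0.
Qed.

Lemma constant_abscissa (c : k) v : v ^+ 2 = (fcub t).[phi c%:P] ->
  phi c%:P \in branch K.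
Proof.
rewrite fcubE => e.
pose s : seq {poly k} :=
  [:: Poly [:: - (c ^+ 3 - c + 1); - (4 * c ^+ 2 + 4); - 16]; 0].
have [||p ev] := @phi_integral 2 (nth 0 s) 1 1 v.
- by rewrite !big_ord_recr big_ord0 /= !cons_poly_def e; ring.
- case=> [|[|]] // _; last by rewrite size_poly0.
  by apply: leq_trans (leq_mul (leqnn _) (size_Poly_pred _)) _.
rewrite mul1n -subn1 leq_subLR => /size_le2_poly[d [b ep]]; rewrite {}ep in ev.
have E : Poly [:: b ^+ 2 - (c ^+ 3 - c + 1); 2 * d * b - (4 * c ^+ 2 + 4);
    d ^+ 2 - 16] = 0 :> {poly k}.
  apply: phi_eq0; transitivity (v ^+ 2 - v ^+ 2); last by rewrite subrr.
  by rewrite [X in _ = _ - X]e ev /= !cons_poly_def; ring.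
have := Poly_eq0 0 E; have := Poly_eq0 1 E; have := Poly_eq0 2 E => /=.
move=> /subr0_eq e2 /subr0_eq e1 /subr0_eq e0.
have : 4 ^+ 2 * ((c - 1) * (c - 1) * (c + 1) * (c - 3)) = 0.
  transitivity ((2 * d * b) ^+ 2 - 4 * d ^+ 2 * b ^+ 2); last by ring.
  by rewrite e1 e2 e0; ring.
move/eqP; rewrite !mulf_eq0 (negPf four_neq0) !subr_eq0 addr_eq0 /= orbb.
by move=> /orP[/orP[]|] /eqP->; rewrite !inE ?polyCN ?rmorphN ?polyC_natr
  ?rmorph_nat ?rmorph1 ?eqxx ?orbT.
Qed.

Lemma quartic_constant b0 b1 c0 c1 c2 d0 d1 l :
  l ^+ 4 + phi (Poly [:: d0; d1]) * l ^+ 2 + phi (Poly [:: b0; b1]) * l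
  + phi (Poly [:: c0; c1; c2]) = 0 ->
  exists e, [/\ e ^+ 4 + d0 * e ^+ 2 + b0 * e + c0 = 0,
    d1 * e ^+ 2 + b1 * e + c1 = 0 & c2 = 0].
Proof.
move=> e.
pose s : seq {poly k} :=
  [:: Poly [:: c0; c1; c2]; Poly [:: b0; b1]; Poly [:: d0; d1]; 0].
have [||p el] := @phi_integral 4 (nth 0 s) 2 1 l.
- by rewrite !big_ord_recr big_ord0 -[RHS]e /=; ring.
- case=> [|[|[|[|]]]] // _; last by rewrite size_poly0.
  + by apply: leq_trans (leq_mul (leqnn _) (size_Poly_pred _)) _.
  + by apply: leq_trans (leq_mul (leqnn _) (size_Poly_pred _)) _.
  + by apply: leq_trans (leq_mul (leqnn _) (size_Poly_pred _)) _.
move=> sp; have /size1_polyC ep : (size p <= 1)%N.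
  by case: (size p) sp => [|[|n]] //=; rewrite !mulnS.
move: (p`_0) ep => r ep; rewrite {}ep in el; exists r.
have E : Poly [:: r ^+ 4 + d0 * r ^+ 2 + b0 * r + c0;
    d1 * r ^+ 2 + b1 * r + c1; c2] = 0.
  by apply: phi_eq0; rewrite -[RHS]e el /= !cons_poly_def; ring.
by split; [exact: Poly_eq0 0 E | exact: Poly_eq0 1 E | exact: Poly_eq0 2 E].
Qed.

Section Group.
Variable E : ecurve K.
Hypotheses (a2E : ec_a2 E = t) (a4E : ec_a4 E = -1)
           (a6E : ec_a6 E = t ^+ 2 + t + 1).
Implicit Types (S T : point E) (u v : K).

Let two_neq0K : 2 != 0 :> K := two_neq0 E.

Lemma point_add_slope S T x1 y1 x2 y2 s :
  point_val S = Some (x1, y1) -> point_val T = Some (x2, y2) ->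
  (x1, y1) != (x2, - y2) -> y1 - y2 = s * (x1 - x2) ->
  s * (y1 + y2) = x1 ^+ 2 + x1 * x2 + x2 ^+ 2 + t * (x1 + x2) - 1 ->
  let x3 := s ^+ 2 - t - x1 - x2 in
  point_val (S + T) = Some (x3, s * (x1 - x3) - y1).
Proof.
move=> e1 e2 n12 s1 s2 /=.
have h1 : oncurve E (Some (x1, y1)) by rewrite -e1 point_on.
have h2 : oncurve E (Some (x2, y2)) by rewrite -e2 point_on.
have := is_slope_add h1 h2 n12 (s := s); rewrite a2E a4E => /(_ (conj s1 s2)).
by rewrite -e1 -e2.
Qed.

Lemma no_two_torsion S : S + S = 0 -> S = 0.
Proof.
case: S => [[[u v]|] h] e; last exact: val_inj.
have /(congr1 (@point_val K E)) : Point h = - Point h.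
  by apply/eqP; rewrite -addr_eq0 e.
case=> /(opp_fix E) v0; case/eqP: (fcub_neq0 u).
have <- := point_fcub a2E a4E a6E (erefl : point_val (Point h) = Some (u, v)).
by rewrite v0 expr0n.
Qed.

Lemma double_slope S x y : point_val (S + S) = Some (x, y) ->
  exists u l, [/\ l ^+ 2 = t + x + 2 * u &
    2 * l * (l * (u - x) - y) = 3 * u ^+ 2 + 2 * t * u - 1].
Proof.
case eS: (point_val S) => [[u v]|]; last first.
  by have -> : S = 0 by [apply: val_inj]; rewrite addr0.
have v0 : v != 0.
  apply: contraNneq (fcub_neq0 u) => v0.
  by rewrite -(point_fcub a2E a4E a6E eS) v0 expr0n.
pose l := (3 * u ^+ 2 + 2 * t * u - 1) / (2 * v).
have el : 2 * l * v = 3 * u ^+ 2 + 2 * t * u - 1.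
  by rewrite /l; field; rewrite v0.
rewrite (point_add_slope (s := l) eS eS).
- move=> [ex ey]; exists u, l; split; first by rewrite -ex; ring.
  by rewrite -ey -ex -el; ring.
- rewrite xpair_eqE eqxx /=; apply: contraNneq v0 => /(opp_fix E) -> //.
- by rewrite !subrr mulr0.
- by transitivity (2 * l * v); [ring | rewrite el; ring].
Qed.

Variables P Q : point E.
Hypotheses (eP : point_val P = Some (1, t + 1))
           (eQ : point_val Q = Some (-1, t + 1)).

Let t0 : t != 0.
Proof.
have -> : t = phi (4%:P * 'X) by ring.
by rewrite phi_neq0 // mulf_neq0 ?polyX_eq0 // polyC_eq0.
Qed.

Let t10 : t + 1 != 0.
Proof.
have -> : t + 1 = phi (Poly [:: 1; 4]) by rewrite /= !cons_poly_def; ring.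
apply: phi_neq0; apply: contraNneq (oner_neq0 k) => e.
by have := Poly_eq0 0 e => /= ->.
Qed.

Lemma val_PQ : point_val (P + Q) = Some (- t, - (t + 1)).
Proof.
rewrite (point_add_slope (s := 0) eP eQ); first by congr (Some (_, _)); ring.
- by rewrite xpair_eqE -subr_eq0 opprK -mulr2n (negPf two_neq0K).
- by rewrite subrr mul0r.
- by ring.
Qed.

Lemma val_PP : point_val (P + P) = Some (- 1 - t, 1).
Proof.
rewrite (point_add_slope (s := 1) eP eP); first by congr (Some (_, _)); ring.
- by rewrite xpair_eqE eqxx; apply: contraNneq t10 => /(opp_fix E)/eqP.
- by rewrite !subrr mulr0.
- by ring.
Qed.

Lemma val_PPQ : point_val (P + P + Q) = Some (3, - (t + 5)).
Proof.
rewrite (point_add_slope (s := 1) val_PP eQ).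
- by congr (Some (_, _)); ring.
- by rewrite xpair_eqE -subr_eq0 opprK addrAC addNr sub0r oppr_eq0 (negPf t0).
- by ring.
- by ring.
Qed.

Let sixteen_neq0 : 16 != 0 :> k.
Proof. by rewrite -[16%N]/(4 * 4)%N natrM mulf_neq0. Qed.

(* If [S + S] has abscissa [x], the tangent at [S] of slope [l] meets the cubic
   in a quadratic polynomial which is a square; its discriminant is the quartic
   in [l] below. *)
Lemma double_neqP S : S + S != P.
Proof.
apply/eqP => e; have := eP; rewrite -e => /double_slope[u [l [e1 e2]]].
have [|r [_ _ /eqP]] := @quartic_constant (-8) (-32) 1 (-8) 16 (-6) (-8) l.
  transitivity ((t + 1 - l ^+ 2) ^+ 2 - 4 * t - 8 * (t + 1) * l - 4 * l ^+ 2).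
    by rewrite /= !cons_poly_def; ring.
  move: t e1 e2 => t' e1; have -> : t' = l ^+ 2 - 1 - 2 * u by rewrite e1; ring.
  move/eqP; rewrite -subr_eq0 => /eqP e2; rewrite -[RHS](mulr0 4) -e2; ring.
by rewrite (negPf sixteen_neq0).
Qed.

Lemma double_neqQ S : S + S != Q.
Proof.
apply/eqP => e; have := eQ; rewrite -e => /double_slope[u [l [e1 e2]]].
have [|r [_ _ /eqP]] := @quartic_constant (-8) (-32) 1 8 16 6 (-8) l.
  transitivity ((t - 1 - l ^+ 2) ^+ 2 + 4 * t - 8 * (t + 1) * l + 4 * l ^+ 2).
    by rewrite /= !cons_poly_def; ring.
  move: t e1 e2 => t' e1; have -> : t' = l ^+ 2 + 1 - 2 * u by rewrite e1; ring.
  move/eqP; rewrite -subr_eq0 => /eqP e2; rewrite -[RHS](mulr0 4) -e2; ring.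
by rewrite (negPf sixteen_neq0).
Qed.

Lemma double_neqPQ S : S + S != P + Q.
Proof.
apply/eqP => e; have := val_PQ; rewrite -e => /double_slope[u [l [e1 e2]]].
have [|r [r0 r1 _]] := @quartic_constant 8 32 4 0 0 0 16 l.
  transitivity ((l ^+ 2) ^+ 2 + 4 * (1 + 2 * l * (t + 1) + t * l ^+ 2)).
    by rewrite /= !cons_poly_def; ring.
  move: t e1 e2 => t' e1; have {e1} l2 : l ^+ 2 = 2 * u by rewrite e1; ring.
  have -> : 2 * l * (l * (u - - t') - - (t' + 1)) =
      2 * l ^+ 2 * (u + t') + 2 * l * (t' + 1) by ring.
  rewrite l2 => /eqP; rewrite -subr_eq0 => /eqP e2.
  rewrite -[RHS](mulr0 4) -e2; ring.
have : 16 * (r * (r + 2)) = 0 by rewrite -r1; ring.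
move/eqP; rewrite !mulf_eq0 (negPf sixteen_neq0) /= addr_eq0.
move=> /orP[/eqP er|/eqP er].
  have /eqP : 4 = 0 :> k by rewrite -r0 er; ring.
  by rewrite (negPf four_neq0).
have /eqP : 4 = 0 :> k by rewrite -r0 er; ring.
by rewrite (negPf four_neq0).
Qed.

Lemma int_parity (m : int) :
  exists m' (b : bool), m = m' + m' + b%:Z /\ (`|m'| + `|m'| <= `|m| + b)%N.
Proof.
by exists (m %/ 2)%Z, (m %% 2 == 1)%Z; split; lia.
Qed.

Lemma PQ_independent m n : P *~ m + Q *~ n = 0 -> m = 0 /\ n = 0.
Proof.
have [N] := ubnP (`|m| + `|n|)%N; elim: N m n => // N IHN m n lN e.
have [m' [b [em lm]]] := int_parity m; have [n' [c [en ln]]] := int_parity n.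
pose S := P *~ m' + Q *~ n'.
have eS : S + S + (P *+ b + Q *+ c) = 0.
  rewrite -[RHS]e em en !mulrzDr -!pmulrn /S.
  by rewrite (addrACA (P *~ m')) (addrACA (P *~ m' + P *~ m')).
have eSN T : S + S + T = 0 -> - S - S = T.
  by rewrite -opprD => /eqP; rewrite addr_eq0 => /eqP ->; rewrite opprK.
case: b c em en lm ln eS => [] [] em en lm ln;
  rewrite ?mulr1n ?mulr0n ?addr0 ?add0r => eS.
- by case/eqP: (double_neqPQ (- S)); apply: eSN.
- by case/eqP: (double_neqP (- S)); apply: eSN.
- by case/eqP: (double_neqQ (- S)); apply: eSN.
have [mn0|mn0] := posnP (`|m| + `|n|)%N; first by split; lia.
have [|m0 n0] := IHN m' n' _ (no_two_torsion eS); first by lia.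
by rewrite em en m0 n0.
Qed.

Definition in_span S := exists m n : int, S = P *~ m + Q *~ n.

Lemma in_spanB S T : in_span S -> in_span T -> in_span (S - T).
Proof.
move=> [m [n ->]] [m' [n' ->]]; exists (m - m'), (n - n').
by rewrite !mulrzBr opprD addrACA.
Qed.

Lemma in_spanN S : in_span S -> in_span (- S).
Proof.
by move=> [m [n ->]]; exists (- m), (- n); rewrite !mulrNz opprD.
Qed.

Lemma branch_in_span S u v :
  point_val S = Some (u, v) -> u \in branch K -> in_span S.
Proof.
move=> eS; have same T w : point_val T = Some (u, w) -> in_span T -> in_span S.
  move=> eT GT; have h1 : oncurve E (Some (u, v)) by rewrite -eS point_on.
  have h2 : oncurve E (Some (u, w)) by rewrite -eT point_on.
  case: (oncurve_same_x h1 h2) => evw.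
    by have -> : S = T by apply: val_inj; rewrite /= eS eT evw.
  have -> : S = - T by apply: val_inj; rewrite /= eS eT evw.
  exact: in_spanN.
rewrite !inE => /or3P[] /eqP eu; rewrite eu in same.
- by apply: same eP _; exists 1, 0; rewrite mulr1z mulr0z addr0.
- by apply: same eQ _; exists 0, 1; rewrite mulr1z mulr0z add0r.
- by apply: same val_PPQ _; exists 2, 1; rewrite mulr1z.
Qed.

Hypothesis phi_frac : forall z, exists X D, D != 0 /\ z = phi X / phi D.
Hypothesis phi_algebraic : forall (b : {poly k}) z, b != 0 ->
  root (map_poly (phi \o polyC) b) z -> exists c, z = phi c%:P.

Lemma PQ_generate S : in_span S.
Proof.
case eS: (point_val S) => [[u v]|]; last first.
  by exists 0, 0; rewrite !mulr0z addr0; apply: val_inj.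
have [ub|nub] := boolP (u \in branch K); first exact: branch_in_span eS ub.
have ev := point_fcub a2E a4E a6E eS.
have v0 : v != 0.
  by apply: contraNneq (fcub_neq0 u) => v0; rewrite -ev v0 expr0n.
have [b b0|x [M [n [x0 nx dvd M0]]]] :=
    vanishing_function char_neq2 phi_neq0 phi_frac v0 ev nub.
  apply: contraNneq nub => /eqP /(phi_algebraic b0)[c ec].
  by rewrite ec; apply: (constant_abscissa (v := v)); rewrite -ec.
exact: (mem_of_split_norm a2E a4E a6E in_spanB branch_in_span eS x0 nx dvd M0).
Qed.

End Group.
End RationalPoints.

(** * Rank *)

Lemma int_kernel (n r : nat) (C : 'I_n -> 'I_r -> int) : (r < n)%N ->
  exists2 c : 'I_n -> int, (exists i, c i != 0) &
    forall j, \sum_i C i j * c i = 0.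
Proof.
move=> lt_rn; pose A : 'M[rat]_(n, r) := \matrix_(i, j) (C i j)%:~R.
have : kermx A != 0.
  rewrite kermx_eq0 -row_leq_rank -ltnNge.
  exact: leq_ltn_trans (rank_leq_col A) lt_rn.
case/rowV0Pn => v /sub_kermxP vA vn0.
pose d := \prod_j denq (v 0 j).
have d0 : d != 0 by apply/prodf_neq0 => j _; rewrite denq_neq0.
pose c i := numq (v 0 i) * \prod_(j | j != i) denq (v 0 j).
have ec i : (c i)%:~R = v 0 i * d%:~R :> rat.
  by rewrite /c [d](bigD1 i) //= !intrM mulrA numqE.
exists c => [|j].
  have [i vi] := rV0Pn _ vn0; exists i.
  by rewrite -(@intr_eq0 rat) ec mulf_neq0 ?intr_eq0.
apply: (@intr_inj rat); rewrite rmorph_sum /= rmorph0.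
transitivity ((v *m A) 0 j * d%:~R); last by rewrite vA mxE mul0r.
rewrite mxE big_distrl; apply: eq_bigr => i _.
by rewrite rmorphM /= ec mxE mulrCA mulrA mulrAC.
Qed.

Lemma zrank_le (V : zmodType) (r n : nat) (p : r.-tuple V) (q : n.-tuple V) :
  zgenerates p -> zindependent q -> (n <= r)%N.
Proof.
move=> gen ind; rewrite leqNgt; apply/negP => lt_rn.
have [C eC] := fin_all_exists (fun i => gen (tnth q i)).
have [c [i ci] cC] := int_kernel C lt_rn.
case/eqP: ci; apply: ind; rewrite /zcomb.
transitivity (\sum_(i < n) \sum_(j < r) tnth p j *~ (C i j * c i)).
  apply: eq_bigr => i' _; rewrite eC /zcomb mulrz_suml; apply: eq_bigr => j _.
  by rewrite mulrzA.
rewrite exchange_big big1 // => j _.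
by rewrite -mulrz_sumr cC mulr0z.
Qed.

(** * Affine changes of coordinates *)

Section Rescale.
Variables (K : fieldType) (E1 E2 : ecurve K) (r s : K).
Hypotheses (r0 : r != 0)
  (e2 : ec_a2 E2 = r ^+ 2 * ec_a2 E1 - 3 * s)
  (e4 : ec_a4 E2 = r ^+ 4 * ec_a4 E1 - 3 * s ^+ 2 - 2 * ec_a2 E2 * s)
  (e6 : ec_a6 E2 =
     r ^+ 6 * ec_a6 E1 - s ^+ 3 - ec_a2 E2 * s ^+ 2 - ec_a4 E2 * s).

Definition raw_rescale (p : option (K * K)) : option (K * K) :=
  if p is Some (u, v) then Some (r ^+ 2 * u + s, r ^+ 3 * v) else None.

Lemma oncurve_rescale p : oncurve E2 (raw_rescale p) = oncurve E1 p.
Proof.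
case: p => [[u v]|] //=; rewrite -[RHS](inj_eq (mulfI (expf_neq0 6 r0))).
by congr (_ == _); [ring | rewrite e6 e4 e2; ring].
Qed.

Lemma raw_add_rescale p q : oncurve E1 p -> oncurve E1 q ->
  raw_add E2 (raw_rescale p) (raw_rescale q) = raw_rescale (raw_add E1 p q).
Proof.
case: p q => [[x1 y1]|] [[x2 y2]|] // h1 h2.
have h1' : oncurve E2 (raw_rescale (Some (x1, y1))) by rewrite oncurve_rescale.
have h2' : oncurve E2 (raw_rescale (Some (x2, y2))) by rewrite oncurve_rescale.
have eqx : (r ^+ 2 * x1 + s == r ^+ 2 * x2 + s) = (x1 == x2).
  by rewrite (inj_eq (addIr s)) (inj_eq (mulfI (expf_neq0 2 r0))).
have eqy : (r ^+ 3 * y1 == - (r ^+ 3 * y2)) = (y1 == - y2).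
  by rewrite -mulrN (inj_eq (mulfI (expf_neq0 3 r0))).
case n12 : ((x1 == x2) && (y1 == - y2)).
  by rewrite /raw_add /= eqx eqy n12.
have n12' : ~~ ((r ^+ 2 * x1 + s == r ^+ 2 * x2 + s) &&
    (r ^+ 3 * y1 == - (r ^+ 3 * y2))) by rewrite eqx eqy n12.
have [s1 s2] := slopeP h1 h2 (negbT n12).
rewrite (is_slope_add h1 h2 (negbT n12) (conj s1 s2)).
move: (slope _ _ _ _ _) s1 s2 => l s1 s2.
apply: etrans (is_slope_add (s := r * l) h1' h2' n12' _) _.
  split; first by rewrite -mulrBr s1; ring.
  rewrite -mulrDr; transitivity (r ^+ 4 * (l * (y1 + y2))); first by ring.
  by rewrite s2 e4 e2; ring.
by congr (Some (_, _)); rewrite e2; ring.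
Qed.

Lemma rescale_on (p : point E1) : oncurve E2 (raw_rescale p).
Proof. by rewrite oncurve_rescale point_on. Qed.

Definition rescale (p : point E1) : point E2 := Point (rescale_on p).

Lemma rescaleD : {morph rescale : p q / p + q}.
Proof. by move=> p q; apply/val_inj/esym/raw_add_rescale; apply: point_on. Qed.

Lemma rescale_zmod : zmod_morphism rescale.
Proof.
move=> p q; apply: (addIr (rescale q)); by rewrite -rescaleD !addrNK.
Qed.

HB.instance Definition _ :=
  GRing.isZmodMorphism.Build (point E1) (point E2) rescale rescale_zmod.

Lemma rescale_surj p : exists q, p = rescale q.
Proof.
case: p => [[[x y]|] h]; last by exists 0; apply: val_inj.
have e : Some (x, y) = raw_rescale (Some ((x - s) / r ^+ 2, y / r ^+ 3)).
  by congr (Some (_, _)); field.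
have h' : oncurve E1 (Some ((x - s) / r ^+ 2, y / r ^+ 3)).
  by rewrite -oncurve_rescale -e.
by exists (Point h'); apply: val_inj.
Qed.

Lemma rescale_inj : injective rescale.
Proof.
move=> [[[x y]|] h] [[[x' y']|] h'] // e; apply: val_inj => //=.
have /= [/addIr/(mulfI (expf_neq0 2 r0)) -> /(mulfI (expf_neq0 3 r0)) -> //] :=
  congr1 (@point_val K E2) e.
Qed.

End Rescale.

Lemma wdisc_rescale (K : fieldType) (a2 a4 a6 r s b2 b4 : K) :
  b2 = r ^+ 2 * a2 - 3 * s -> b4 = r ^+ 4 * a4 - 3 * s ^+ 2 - 2 * b2 * s ->
  wdisc b2 b4 (r ^+ 6 * a6 - s ^+ 3 - b2 * s ^+ 2 - b4 * s) =
  r ^+ 12 * wdisc a2 a4 a6.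
Proof. by move=> -> ->; rewrite /wdisc; ring. Qed.

Lemma E222_rescale (F : fieldType) (a : F) :
  13 != 0 :> F -> 169 != 0 :> F -> 2197 != 0 :> F ->
  let r := 2 : F in let s := - (314 / 13) : F in let t := 4 * a in
  let a2 := 16 * a + 942 / 13 in
  let a4 := 10048%:R / 13 * a + 293084%:R / 169 in
  let a6 := 1024 * a ^+ 2 + 1620800%:R / 169 * a + 30250696%:R / 2197 in
  [/\ a2 = r ^+ 2 * t - 3 * s,
      a4 = r ^+ 4 * (-1) - 3 * s ^+ 2 - 2 * a2 * s &
      a6 = r ^+ 6 * (t ^+ 2 + t + 1) - s ^+ 3 - a2 * s ^+ 2 - a4 * s].
Proof.
move=> h1 h2 h3 r s t a2 a4 a6; rewrite /a6 /a4 /a2 /t /s /r.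
by split; field; rewrite ?h1 ?h2 ?h3.
Qed.

Local Notation t222 := (4 * a_ : Qa).
Local Notation r222 := (2 : Qa).
Local Notation s222 := (- (314 / 13) : Qa).

Lemma E222_coefE : [/\ E222_a2 = r222 ^+ 2 * t222 - 3 * s222,
  E222_a4 = r222 ^+ 4 * (-1) - 3 * s222 ^+ 2 - 2 * E222_a2 * s222 &
  E222_a6 = r222 ^+ 6 * (t222 ^+ 2 + t222 + 1) - s222 ^+ 3
            - E222_a2 * s222 ^+ 2 - E222_a4 * s222].
Proof. by apply: E222_rescale; apply: Qa_natr_neq0. Qed.

Lemma short222_disc : wdisc t222 (-1) (t222 ^+ 2 + t222 + 1) != 0.
Proof.
have [e2 e4 e6] := E222_coefE; have := E222_disc_neq0.
rewrite [X in wdisc _ _ X]e6 (wdisc_rescale _ e2 e4).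
by rewrite mulf_eq0 negb_or => /andP[].
Qed.

Definition short222 : ecurve Qa := ECurve short222_disc.

Definition tofracQ : {rmorphism {poly rat} -> Qa} := @tofrac {poly rat}.

Lemma short222_val_exists (u : Qa) : u = 1 \/ u = -1 ->
  exists S : point short222, point_val S = Some (u, t222 + 1).
Proof.
move=> eu; apply: (point_exists (t := t222)) => //; rewrite fcubE.
have -> : u ^+ 2 = 1 by case: eu => ->; rewrite ?sqrrN expr1n.
by rewrite subrr mul0r add0r.
Qed.

Lemma rescale_PQ_coord (F : fieldType) (a : F) : 13 != 0 :> F ->
  [/\ 2 ^+ 2 * 1 + - (314 / 13) = - (262 / 13) :> F,
      2 ^+ 2 * -1 + - (314 / 13) = - (366 / 13) :> F &
      2 ^+ 3 * (4 * a + 1) = 32 * a + 8 :> F].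
Proof. by move=> h; split; field; rewrite ?h. Qed.

Lemma zcomb_pair (V : zmodType) (x y : V) (c : 'I_2 -> int) :
  zcomb [tuple x; y] c = x *~ c ord0 + y *~ c ord_max.
Proof.
rewrite /zcomb !big_ord_recl big_ord0 addr0 !(tnth_nth 0) /=.
by congr (_ + _ *~ c _); apply: val_inj.
Qed.

Lemma E222_PQ :
  (forall m n : int, P222 *~ m + Q222 *~ n = 0 -> m = 0 /\ n = 0) /\
  (forall S, exists m n : int, S = P222 *~ m + Q222 *~ n).
Proof.
have [e2 e4 e6] := E222_coefE; have r0 : r222 != 0 by exact: Qa_natr_neq0.
pose Psi : {additive point short222 -> point E222} :=
  @rescale Qa short222 E222 _ _ r0 e2 e4 e6.
have [eP eQ ey] := rescale_PQ_coord a_ (@Qa_natr_neq0 13 isT).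
have [P vP] := short222_val_exists (or_introl erefl).
have [Q vQ] := short222_val_exists (or_intror erefl).
have psiP : P222 = Psi P.
  by apply: val_inj; rewrite /= vP /= ey eP.
have psiQ : Q222 = Psi Q.
  by apply: val_inj; rewrite /= vQ /= ey eQ.
have psi_comb m n : P222 *~ m + Q222 *~ n = Psi (P *~ m + Q *~ n).
  by rewrite psiP psiQ raddfD !raddfMz.
have neq2 : 2 != 0 :> rat by [].
have phi_neq0 (X : {poly rat}) : X != 0 -> tofracQ X != 0.
  by move=> X0; rewrite tofrac_eq0.
have phi_frac (z : Qa) : exists X D, D != 0 /\ z = tofracQ X / tofracQ D.
  by have [[X D] D0 ->] := fracP z; exists X, D.
split=> [m n|S].
  rewrite psi_comb => e; apply: (PQ_independent neq2 phi_neq0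
    (@frac_integral_size rat) (E := short222) erefl erefl erefl vP vQ).
  have inj : injective Psi by exact: rescale_inj.
  by apply: inj; rewrite raddf0.
have [T ->] := rescale_surj r0 (E1 := short222) (E2 := E222) e2 e4 e6 S.
have [m [n ->]] := PQ_generate neq2 phi_neq0 (@frac_integral_size rat)
  (E := short222) erefl erefl erefl vP vQ phi_frac (@frac_algebraic rat) T.
by exists m, n; rewrite psi_comb.
Qed.

Theorem theorem3p3 :
  has_zrank (point E222) 2 /\
  zindependent [tuple P222; Q222] /\
  zgenerates [tuple P222; Q222].
Proof.
have [ind gen] := E222_PQ.
have zind : zindependent [tuple P222; Q222].
  move=> c; rewrite zcomb_pair => /ind[c0 c1] i.
  by case: (unliftP ord0 i) => [j|] ->; rewrite // ord1 -[RHS]c1; congr (c _);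
    apply: val_inj.
have zgen : zgenerates [tuple P222; Q222].
  move=> S; have [m [n ->]] := gen S.
  by exists (fun i => if i == ord0 then m else n); rewrite zcomb_pair.
split=> //; split; first by exists [tuple P222; Q222].
by move=> n p; apply: zrank_le zgen.
Qed.
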